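(* Let $Q$ be a rooted tree quiver. Let $\mathbf{rep}_{H_0}(Q)\subseteq\mathbf{rep}(Q)$ be the essential image of the zero-dimensional persistent homology functor $H_0:\mathbf{top}^Q\to\mathbf{rep}(Q)$. Then the additive closure $\mathrm{add}(\mathbf{rep}_{H_0}(Q))$ is of finite type (that is, it has finitely many isomorphism classes of indecomposable objects), and its indecomposable objects are exactly the reduced rooted tree modules over $Q$.
   Context: Fix a field $\Bbbk$. All quivers are finite and all representations are finite dimensional over $\Bbbk$. A tree quiver is a quiver whose underlying undirected graph is a tree (connected, no cycles). A rooted tree quiver is a tree quiver with exactly one vertex $\sigma$ of out-degree zero, called its root. For vertices $x,y$ of a tree quiver $Q$, write $x\leq_Q y$ if there is a (possibly empty) directed path from $x$ to $y$; $Q_{\leq x}$ denotes the subquiver spanned by the vertices $y\leq_Q x$, which is a rooted tree quiver with root $x$. A quiver morphism $f:Q'\to Q$ is a pair of functions on vertices and edges, $f_0$ and $f_1$, respecting sources and targets. A rooted tree quiver over a rooted tree quiver $Q$ is a pair $(T,f_T)$ with $T$ a rooted tree quiver and $f_T:T\to Q$ a quiver morphism sending the root of $T$ to the root of $Q$. A morphism over $Q$ from $(S,f_S)$ to $(T,f_T)$ is a quiver morphism $g:S\to T$, preserving roots, with $f_T\circ g=f_S$. The rooted tree quiver $T$ over $Q$ is reduced if its only endomorphism over $Q$ is the identity. $\mathbf{rep}(Q)$ is the category of representations of $Q$. The path category of $Q$ (also denoted $Q$) has as objects the vertices of $Q$ and as morphisms $x\to y$ the (possibly empty) directed paths from $x$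 to $y$; $\mathbf{rep}(Q)$ is canonically equivalent to the category of functors from the path category of $Q$ to finite dimensional $\Bbbk$-vector spaces. $\mathbf{top}$ is the category of topological spaces with finitely many path-connected components, $\mathbf{top}^Q$ is the category of functors from the path category of $Q$ to $\mathbf{top}$, and $H_0:\mathbf{top}^Q\to\mathbf{rep}(Q)$ is post-composition with the zeroth homology functor $H_0(-;\Bbbk)$ followed by this equivalence. The additive closure of a collection of objects is formed by taking all (finite) direct sums of all direct summands of objects in the collection. For a quiver morphism $f:Q'\to Q$, the push-forward $f_*:\mathbf{rep}(Q')\to\mathbf{rep}(Q)$ is given by $f_*(V)_x=\bigoplus_{y\in f_0^{-1}(x)}V_y$ and $f_*(V)_\alpha=\sum_{\beta\in f_1^{-1}(\alpha)}V_\beta$. The constant representation $\mathbb{1}_T$ has $\Bbbk$ at every vertex and the identity at every arrow. The linearization of $(T,f_T:T\to Q)$ is $\Bbbk_T:=(f_T)_*(\mathbb{1}_T)\in\mathbf{rep}(Q)$. A representation $V\in\mathbf{rep}(Q)$ is a reduced rooted tree module over $Q$ if there exist a vertex $x\in Q_0$ and a reduced rooted tree quiver $(T,f_T:T\to Q_{\leq x})$ over $Q_{\leq x}$ such that $V\cong\iota_*(\Bbbk_T)$, where $\iota:Q_{\leq x}\to Q$ is the inclusion. *)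

(* Defs.v *)
From HB Require Import structures.
From mathcomp Require Import all_boot all_order all_algebra.
From mathcomp Require Import generic_quotient ring_quotient.
From mathcomp Require Import boolp classical_sets functions cardinality.
From mathcomp Require Import set_interval reals topology normedtype.
From mathcomp Require Import freeg.

Set Implicit Arguments.
Unset Strict Implicit.
Unset Printing Implicit Defensive.

Import Order.TTheory GRing.Theory Num.Theory.
Import numFieldNormedType.Exports.
Local Open Scope ring_scope.

Section DirectSum.
Import VectorInternalTheory.
Variables (k : fieldType) (I : finType) (V : I -> vectType k).

(* MathComp has a [vectType] of functions on a finite type only when the
   codomain is constant. *)
Definition dsum := {dffun forall i, V i}.
HB.instance Definition _ := Choice.on dsum.

Implicit Types (a : k) (u v w : dsum).

Definition dsum_add u v : dsum := [ffun i => u i + v i].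
Definition dsum_opp u : dsum := [ffun i => - u i].
Definition dsum_zero : dsum := [ffun i => 0].
Definition dsum_scale a u : dsum := [ffun i => a *: u i].

Fact dsum_addA : associative dsum_add.
Proof. by move=> u v w; apply/ffunP=> i; rewrite !ffunE addrA. Qed.
Fact dsum_addC : commutative dsum_add.
Proof. by move=> u v; apply/ffunP=> i; rewrite !ffunE addrC. Qed.
Fact dsum_add0 : left_id dsum_zero dsum_add.
Proof. by move=> u; apply/ffunP=> i; rewrite !ffunE add0r. Qed.
Fact dsum_addN : left_inverse dsum_zero dsum_opp dsum_add.
Proof. by move=> u; apply/ffunP=> i; rewrite !ffunE addNr. Qed.
HB.instance Definition _ :=
  GRing.isZmodule.Build dsum dsum_addA dsum_addC dsum_add0 dsum_addN.

Fact dsum_scaleA a b u : dsum_scale a (dsum_scale b u) = dsum_scale (a * b) u.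
Proof. by apply/ffunP=> i; rewrite !ffunE scalerA. Qed.
Fact dsum_scale1 : left_id 1 dsum_scale.
Proof. by move=> u; apply/ffunP=> i; rewrite !ffunE scale1r. Qed.
Fact dsum_scaleDr : right_distributive dsum_scale +%R.
Proof. by move=> a u v; apply/ffunP=> i; rewrite !ffunE scalerDr. Qed.
Fact dsum_scaleDl u : {morph dsum_scale^~ u : a b / a + b}.
Proof. by move=> a b; apply/ffunP=> i; rewrite !ffunE scalerDl. Qed.
HB.instance Definition _ := GRing.Zmodule_isLmodule.Build k dsum
  dsum_scaleA dsum_scale1 dsum_scaleDr dsum_scaleDl.

Lemma dsum_addE u v i : (u + v) i = u i + v i. Proof. by rewrite ffunE. Qed.
Lemma dsum_scaleE a u i : (a *: u) i = a *: u i. Proof. by rewrite ffunE. Qed.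

Fact dsum_vect_iso :
  Vector.axiom #|{: {i : I & 'I_(dim (V i))}}| dsum.
Proof.
pose ix i (j : 'I_(dim (V i))) := Tagged (fun i => 'I_(dim (V i))) j.
exists (fun u : dsum => \row_(t < #|{: {i : I & 'I_(dim (V i))}}|)
    v2r (u (tag (enum_val t))) 0 (tagged (enum_val t))).
  move=> a u v; apply/rowP=> t.
  by rewrite !mxE dsum_addE dsum_scaleE linearP !mxE.
exists (fun r : 'rV_#|{: {i : I & 'I_(dim (V i))}}| =>
    [ffun i => r2v (\row_j r 0 (enum_rank (ix i j)))] : dsum).
  move=> u; apply/ffunP=> i; rewrite ffunE; apply: (canLR v2rK).
  by apply/rowP=> j; rewrite !mxE enum_rankK.
move=> r; apply/rowP=> t; rewrite !mxE ffunE r2vK mxE.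
by congr (r 0 _); rewrite -[RHS]enum_valK; congr enum_rank; case: (enum_val t).
Qed.
HB.instance Definition _ := Lmodule_hasFinDim.Build k dsum dsum_vect_iso.

Definition dsum_pr i : 'Hom(dsum, V i) := linfun (fun u : dsum => u i).
Definition dsum_in i : 'Hom(V i, dsum) :=
  linfun (fun x : V i => [ffun j => dfwith (fun j => 0 : V j) x j] : dsum).

Lemma dsum_prE i u : dsum_pr i u = u i.
Proof.
have lin_pr : linear (fun u : dsum => u i).
  by move=> a v w; rewrite dsum_addE dsum_scaleE.
pose h : {linear dsum -> V i} := HB.pack (fun u : dsum => u i)
  (GRing.isLinear.Build _ _ _ _ _ lin_pr).
by rewrite /dsum_pr (lfunE h).
Qed.

Lemma dsum_inE i x j : dsum_in i x j = dfwith (fun j => 0 : V j) x j.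
Proof.
pose f (x : V i) : dsum := [ffun j => dfwith (fun j => 0 : V j) x j].
have lin_f : linear f.
  move=> a v w; apply/ffunP=> l; rewrite dsum_addE dsum_scaleE !ffunE.
  case: (eqVneq i l) => [<-|Dil]; first by rewrite !dfwith_in.
  by rewrite !dfwith_out // scaler0 addr0.
pose h : {linear V i -> dsum} := HB.pack f (GRing.isLinear.Build _ _ _ _ _ lin_f).
by rewrite /dsum_in (lfunE h) ffunE.
Qed.

End DirectSum.

Section Cokernel.
Variables (k : fieldType) (U V : lmodType k) (f : {linear U -> V}).

Definition lin_image : {pred V} := [pred v | `[< exists u, f u = v >]].

Lemma lin_imageP v : reflect (exists u, f u = v) (v \in lin_image).
Proof. exact: asboolP. Qed.

Fact lin_image_zmod_closed : zmod_closed lin_image.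
Proof.
split=> [|v w /lin_imageP[u <-] /lin_imageP[u' <-]]; apply/lin_imageP.
  by exists 0; rewrite linear0.
by exists (u - u'); rewrite linearB.
Qed.
HB.instance Definition _ :=
  GRing.isZmodClosed.Build V lin_image lin_image_zmod_closed.

Definition coker : Type := Quotient.quot lin_image.
HB.instance Definition _ := GRing.Zmodule.on coker.

Definition coker_pi (v : V) : coker := \pi_(Quotient.quot lin_image)%qT v.
Definition coker_repr (c : coker) : V := repr (c : Quotient.quot lin_image).

Lemma coker_reprK : cancel coker_repr coker_pi.
Proof. by move=> c; apply: reprK. Qed.

Lemma coker_eq v w : (coker_pi v = coker_pi w) <-> exists u, f u = v - w.
Proof.
split=> [/eqP|/lin_imageP vw].
  by rewrite -[_ == _]Quotient.idealrBE => /lin_imageP.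
by apply/eqP; rewrite -[_ == _]Quotient.idealrBE.
Qed.

Lemma coker_piD v w : coker_pi (v + w) = coker_pi v + coker_pi w.
Proof. exact: raddfD (\pi_(Quotient.quot lin_image)%qT) v w. Qed.

Definition coker_scale (a : k) (c : coker) : coker :=
  coker_pi (a *: coker_repr c).

Lemma coker_piZ a v : coker_pi (a *: v) = coker_scale a (coker_pi v).
Proof.
apply/coker_eq; rewrite -scalerBr.
have /esym/coker_eq[u <-] := coker_reprK (coker_pi v).
by exists (a *: u); rewrite linearZ.
Qed.

Fact coker_scaleA a b c : coker_scale a (coker_scale b c) = coker_scale (a * b) c.
Proof. by rewrite -[c]coker_reprK -!coker_piZ scalerA. Qed.
Fact coker_scale1 : left_id 1 coker_scale.
Proof. by move=> c; rewrite -[c]coker_reprK -!coker_piZ scale1r. Qed.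
Fact coker_scaleDr : right_distributive coker_scale +%R.
Proof.
move=> a c d; rewrite -[c]coker_reprK -[d]coker_reprK.
by rewrite -coker_piD -!coker_piZ scalerDr coker_piD.
Qed.
Fact coker_scaleDl c : {morph coker_scale^~ c : a b / a + b}.
Proof.
by move=> a b; rewrite -[c]coker_reprK -!coker_piZ scalerDl coker_piD.
Qed.
HB.instance Definition _ := GRing.Zmodule_isLmodule.Build k coker
  coker_scaleA coker_scale1 coker_scaleDr coker_scaleDl.

Fact coker_pi_linear : linear coker_pi.
Proof. by move=> a v w; rewrite coker_piD coker_piZ. Qed.
HB.instance Definition _ := GRing.isLinear.Build k V coker _ coker_pi coker_pi_linear.

End Cokernel.

Section FreeModule.
Variables (k : fieldType) (K : choiceType) (M : lmodType k) (f : K -> M).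

Fact fglift_is_linear : linear (fglift f : {freeg K / k} -> M).
Proof.
pose g : {additive {freeg K / k} -> M} := HB.pack (fglift f)
  (GRing.isZmodMorphism.Build _ _ _ (lift_is_additive f)).
have gZ a D : g (a *: D) = a *: g D.
  have -> : g D = \sum_(x <- dom D) coeff x D *: f x.
    rewrite -{1}(freeg_sumE D) (raddf_sum g).
    by apply: eq_bigr => x _; rewrite /= liftU.
  have -> : a *: D = \sum_(x <- dom D) << a * coeff x D *g x >> by [].
  rewrite (raddf_sum g) scaler_sumr; apply: eq_bigr => x _.
  by rewrite /= liftU scalerA.
by move=> a D E; rewrite -[fglift f]/(g : _ -> _) raddfD /= -gZ.
Qed.
HB.instance Definition _ :=
  GRing.isLinear.Build k {freeg K / k} M _ (fglift f) fglift_is_linear.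

Lemma fglift1 (x : K) : fglift f (<< x >> : {freeg K / k}) = f x.
Proof. by rewrite liftU scale1r. Qed.

End FreeModule.

Section SingularHomology.
Variable R : realType.
Local Open Scope classical_set_scope.

(* The standard 1-simplex, with the subspace topology. *)
Definition unitI : set R := `[0%R, 1%R]%classic.

Fact unitI0_subproof : 0%R \in unitI.
Proof. by rewrite inE /unitI /= in_itv /= lexx ler01. Qed.
Fact unitI1_subproof : 1%R \in unitI.
Proof. by rewrite inE /unitI /= in_itv /= lexx ler01. Qed.
Definition unitI0 : unitI := exist (fun x => x \in unitI) 0%R unitI0_subproof.
Definition unitI1 : unitI := exist (fun x => x \in unitI) 1%R unitI1_subproof.

Definition simplex1 (X : topologicalType) := continuousType unitI X.

Definition joined (X : topologicalType) (x y : X) : Prop :=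
  exists p : simplex1 X, p unitI0 = x /\ p unitI1 = y.

Definition path_component (X : topologicalType) (x : X) : set X :=
  [set y | joined x y].

Fact clamp_subproof (t : R) : Num.max 0 (Num.min 1 t) \in unitI.
Proof.
by rewrite inE /unitI /= in_itv /= le_max lexx /= ge_max ler01 ge_min lexx.
Qed.
Definition clamp (t : R) : unitI := exist (fun x => x \in unitI) _ (clamp_subproof t).

Lemma clampK (s : unitI) : clamp (val s) = s.
Proof.
apply/val_inj => /=; case: s => s /= /set_mem; rewrite /unitI /= in_itv /=.
by move=> /andP[s0 s1]; rewrite (min_r s1) (max_r s0).
Qed.

Lemma clamp0 (t : R) : t <= 0 -> clamp t = unitI0.
Proof.
move=> t0; apply/val_inj => /=.
by rewrite (min_r (le_trans t0 ler01)) (max_l t0).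
Qed.

Lemma clamp1 (t : R) : 1 <= t -> clamp t = unitI1.
Proof. by move=> t1; apply/val_inj => /=; rewrite (min_l t1) (max_r ler01). Qed.

Lemma clamp_continuous : continuous clamp.
Proof.
apply: continuous_comp_initial => t /=.
apply: continuous_max; first exact: cst_continuous.
by apply: continuous_min; [exact: cst_continuous|exact: cvg_id].
Qed.

Section Joined.
Variable X : topologicalType.
Implicit Types x y z : X.

Lemma joined_refl x : joined x x.
Proof. by exists (cst x). Qed.

Lemma joined_cont x y (g : R -> X) :
  continuous g -> g 0 = x -> g 1 = y -> joined x y.
Proof.
move=> gc g0 g1.
have pc : continuous (g \o val : unitI -> X).
  by move=> s; apply: continuous_comp; [exact: initial_continuous|exact: gc].
by exists (mkcts pc); split.
Qed.

Lemma simplex_clamp_continuous (p : simplex1 X) : continuous (p \o clamp).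
Proof.
move=> t; apply: continuous_comp; first exact: clamp_continuous.
exact: cts_fun.
Qed.

Lemma joined_sym x y : joined x y -> joined y x.
Proof.
move=> [p [p0 p1]]; apply: (@joined_cont _ _ (p \o clamp \o (fun t => 1 - t))).
- move=> t; apply: continuous_comp; last exact: simplex_clamp_continuous.
  by apply: cvgB; [exact: cvg_cst|exact: cvg_id].
- by rewrite /= subr0 clamp1.
- by rewrite /= subrr clamp0.
Qed.

Lemma joined_trans x y z : joined x y -> joined y z -> joined x z.
Proof.
move=> [p [p0 p1]] [q [q0 q1]].
pose g t := if t <= 0 then (p \o clamp) (t + 1) else (q \o clamp) t.
have gc : continuous g.
  apply/continuous_subspace_setT.
  have -> : [set: R] = [set t | t <= 0] `|` [set t | 0 <= t].
    by apply/seteqP; split => t //= _; apply/orP; exact: le_total.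
  apply: withinU_continuous; [exact: closed_le|exact: closed_ge| |].
    apply: (@subspace_eq_continuous _ _ _ (p \o clamp \o +%R^~ 1)).
      by move=> t /set_mem t0; symmetry; exact: ifT.
    apply: continuous_subspaceT => t.
    apply: continuous_comp; last exact: simplex_clamp_continuous.
    by apply: cvgD; [exact: cvg_id|exact: cvg_cst].
  apply: (@subspace_eq_continuous _ _ _ (q \o clamp)).
    move=> t /set_mem t0; change ((q \o clamp) (t : R) = g t).
    rewrite /g; case: ifP => // t0'.
    have -> : t = 0 :> R by apply/le_anti/andP.
    by rewrite /= add0r clamp0 // clamp1 // q0 p1.
  by apply: continuous_subspaceT; exact: simplex_clamp_continuous.
have hc : continuous (g \o (fun t => t *+ 2 - 1)).
  move=> t; apply: continuous_comp; last exact: gc.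
  apply: cvgB; last exact: cvg_cst.
  by apply: cvgMn; exact: cvg_id.
apply: (joined_cont hc); rewrite /g /=.
  by rewrite mul0rn sub0r oppr_le0 ler01 addNr clamp0.
rewrite mulr2n addrK leNgt ltr01 /=.
by rewrite clamp1.
Qed.

Lemma path_componentP x y : path_component x = path_component y <-> joined x y.
Proof.
split=> [xy|xy]; first by rewrite -[joined x y]/(path_component x y) xy; exact: joined_refl.
apply/seteqP; split => z; first exact/joined_trans/joined_sym.
exact: joined_trans.
Qed.

End Joined.

Variable k : fieldType.

Definition C0 (X : topologicalType) : lmodType k := {freeg X / k}.
Definition C1 (X : topologicalType) : lmodType k := {freeg (simplex1 X) / k}.

Section H0Space.
Variable X : topologicalType.

Definition bdry_simplex1 (p : simplex1 X) : C0 X := << p unitI1 >> - << p unitI0 >>.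
Definition bdry1 : C1 X -> C0 X := fglift bdry_simplex1.
HB.instance Definition _ := GRing.Linear.on bdry1.

(* Every 0-chain is a cycle, so [H0] is the cokernel of the boundary. *)
Definition H0 : lmodType k := coker bdry1.
Definition H0_class (x : X) : H0 := coker_pi bdry1 << x >>.

Lemma H0_class_joined x y : joined x y -> H0_class x = H0_class y.
Proof.
move=> /joined_sym[p [p0 p1]]; apply/coker_eq; exists << p >>.
by rewrite /= /bdry1 fglift1 /bdry_simplex1 p0 p1.
Qed.

Lemma H0_ind (P : H0 -> Prop) :
    (forall x, P (H0_class x)) -> (forall a c, P c -> P (a *: c)) ->
    P 0 -> (forall c d, P c -> P d -> P (c + d)) ->
  forall c, P c.
Proof.
move=> Px PZ P0 PD c; rewrite -[c]coker_reprK -(freeg_sumE (coker_repr c)).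
rewrite (raddf_sum (coker_pi bdry1)); elim/big_ind: _ => // x _.
have -> : << coeff x (coker_repr c) *g x >> = coeff x (coker_repr c) *: (<< x >> : C0 X).
  by apply/eqP/freeg_eqP => y; rewrite coeffZ !coeffU mul1r.
by rewrite /= coker_piZ; exact/PZ/Px.
Qed.

Section Lift.
Variables (M : lmodType k) (f : X -> M).

(* The linear map out of [H0] determined by a function that is constant on
   path components. *)
Definition H0_lift (c : H0) : M := fglift f (coker_repr c).

Hypothesis fJ : forall x y, joined x y -> f x = f y.

Lemma H0_lift_pi (c : C0 X) : H0_lift (coker_pi bdry1 c) = fglift f c.
Proof.
have /coker_eq[u uE] := coker_reprK (coker_pi bdry1 c).
apply/eqP; rewrite -subr_eq0 /H0_lift -raddfB -uE /= /bdry1 -(freeg_sumE u) !raddf_sum; apply/eqP.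
apply: big1 => p _ /=. rewrite liftU linearZ /= raddfB /= !fglift1.
by rewrite (@fJ (p unitI1) (p unitI0)) ?subrr ?scaler0 //; apply: joined_sym; exists p.
Qed.

Lemma H0_lift_class x : H0_lift (H0_class x) = f x.
Proof. by rewrite H0_lift_pi fglift1. Qed.

Lemma H0_lift_linear : linear H0_lift.
Proof.
move=> a c d; rewrite -[c]coker_reprK -[d]coker_reprK -linearP !H0_lift_pi.
by rewrite linearP.
Qed.

End Lift.
End H0Space.

Section H0Functor.
Implicit Types X Y Z : topologicalType.

Definition H0_map X Y (g : continuousType X Y) : H0 X -> H0 Y :=
  H0_lift (fun x => H0_class (g x)).

Lemma joined_map X Y (g : continuousType X Y) x y :
  joined x y -> joined (g x) (g y).
Proof. by move=> [p [<- <-]]; exists (g \o p). Qed.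

Lemma H0_map_class X Y (g : continuousType X Y) x :
  H0_map g (H0_class x) = H0_class (g x).
Proof.
by apply: H0_lift_class => y z yz; apply/H0_class_joined/joined_map.
Qed.

Fact H0_map_linear X Y (g : continuousType X Y) : linear (H0_map g).
Proof.
by apply: H0_lift_linear => y z yz; apply/H0_class_joined/joined_map.
Qed.
HB.instance Definition _ X Y (g : continuousType X Y) :=
  GRing.isLinear.Build k (H0 X) (H0 Y) _ (H0_map g) (H0_map_linear g).

Lemma H0_ext X (M : lmodType k) (f g : {linear H0 X -> M}) :
  (forall x, f (H0_class x) = g (H0_class x)) -> f =1 g.
Proof.
move=> fg; apply: H0_ind => //.
- by move=> a c fgc; rewrite !linearZ fgc.
- by rewrite !linear0.
- by move=> c d fgc fgd; rewrite !linearD fgc fgd.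
Qed.

Lemma H0_map_id X : H0_map (idfun : continuousType X X) =1 id.
Proof.
by apply: (@H0_ext _ _ (H0_map idfun) idfun) => x; rewrite /= H0_map_class.
Qed.

Lemma H0_map_comp X Y Z (f : continuousType X Y) (g : continuousType Y Z) :
  H0_map (g \o f : continuousType X Z) =1 H0_map g \o H0_map f.
Proof.
apply: (@H0_ext _ _ (H0_map (g \o f : continuousType X Z))
                     (H0_map g \o H0_map f)) => x.
by rewrite /= !H0_map_class.
Qed.

End H0Functor.

(* The topologies of MathComp-Analysis are not pointed: the empty space is
   allowed. *)
Record fintop := FinTop {
  fintop_space :> topologicalType;
  fintop_components : finite_set (range (@path_component fintop_space)) }.

Section H0FiniteDim.
Variable X : fintop.

(* [H0 X], with its structure of finite dimensional vector space. *)
Definition H0_fin : Type := H0 X.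
HB.instance Definition _ := GRing.Lmodule.on H0_fin.

Fact H0_fin_dim : {n : nat & Vector.axiom n H0_fin}.
Proof.
have /finite_seqP/cid[s0 s0E] := fintop_components X.
pose s := undup s0; exists (size s).
have sP x : (index (path_component x) s < size s)%N.
  rewrite index_mem mem_undup.
  have : range (@path_component X) (path_component x) by exists x.
  by rewrite s0E.
pose ix x : 'I_(size s) := Ordinal (sP x).
have ixJ x y : joined x y -> ix x = ix y.
  by move=> /path_componentP xy; apply/val_inj; rewrite /= xy.
have ptP (i : 'I_(size s)) : {x : X | ix x = i}.
  apply/cid; have : nth set0 s i \in s0 by rewrite -mem_undup mem_nth.
  have -> : nth set0 s i \in s0 = [set` s0] (nth set0 s i) :> Prop by [].
  rewrite -s0E => -[x _ xE]; exists x; apply/val_inj.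
  by rewrite /= xE index_uniq ?undup_uniq.
pose pt i := projT1 (ptP i).
have ptK i : ix (pt i) = i by exact: projT2 (ptP i).
pose e (x : X) : 'rV[k]_(size s) := delta_mx 0 (ix x).
have eJ x y : joined x y -> e x = e y by move=> /ixJ xy; rewrite /e xy.
have ef x : H0_lift e (H0_class x) = e x by exact: H0_lift_class.
exists (H0_lift e : H0_fin -> _); first exact: H0_lift_linear.
pose h : {linear H0 X -> 'rV[k]_(size s)} := HB.pack (H0_lift e)
  (GRing.isLinear.Build _ _ _ _ _ (H0_lift_linear eJ)).
pose g (r : 'rV[k]_(size s)) : H0 X := \sum_i r 0 i *: H0_class (pt i).
have g_lin : linear g.
  move=> a r t; rewrite /g scaler_sumr -big_split; apply: eq_bigr => i _ /=.
  by rewrite !mxE scalerDl scalerA.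
pose gl : {linear 'rV[k]_(size s) -> H0 X} := HB.pack g
  (GRing.isLinear.Build _ _ _ _ _ g_lin).
exists g.
  move=> c; rewrite -[RHS]/(idfun c) -[LHS]/((gl \o h) c); move: c.
  apply: H0_ext => x /=; rewrite ef /g (bigD1 (ix x)) //= big1 => [|i ne_i].
    rewrite addr0 mxE !eqxx scale1r; apply/H0_class_joined.
    by apply/path_componentP; have := congr1 val (ptK (ix x)) => /=;
       move/(congr1 (nth set0 s)); rewrite !nth_index -?index_mem ?sP.
  by rewrite mxE (negPf ne_i) andbF scale0r.
move=> r; rewrite -[LHS]/(h (g r)) /g linear_sum [RHS]row_sum_delta.
by apply: eq_bigr => i _; rewrite linearZ /= ef /e ptK.
Qed.
HB.instance Definition _ :=
  Lmodule_hasFinDim.Build k H0_fin (projT2 H0_fin_dim).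

End H0FiniteDim.

Definition H0_fin_map (X Y : fintop) (g : continuousType X Y) :
    'Hom(H0_fin X, H0_fin Y) :=
  linfun (H0_map g : H0_fin X -> H0_fin Y).

Lemma H0_fin_mapE (X Y : fintop) (g : continuousType X Y) (c : H0_fin X) :
  H0_fin_map g c = H0_map g c.
Proof.
pose h : {linear H0_fin X -> H0_fin Y} := HB.pack
  (H0_map g : H0_fin X -> H0_fin Y)
  (GRing.isLinear.Build k (H0_fin X) (H0_fin Y) _ _ (@H0_map_linear X Y g)).
by rewrite /H0_fin_map (lfunE h).
Qed.

End SingularHomology.

Record quiver := Quiver {
  vert :> finType;
  arr : finType;
  src : arr -> vert;
  tgt : arr -> vert }.
Arguments src {q}. Arguments tgt {q}.

Record qmor (Q' Q : quiver) := QMor {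
  qmor0 :> Q' -> Q;
  qmor1 : arr Q' -> arr Q;
  qmor_src : forall b, qmor0 (src b) = src (qmor1 b);
  qmor_tgt : forall b, qmor0 (tgt b) = tgt (qmor1 b) }.

(* Directed paths; these are the morphisms of the path category. *)
Inductive qpath (Q : quiver) : Q -> Q -> Type :=
| qnil (x : Q) : qpath x x
| qcons (a : arr Q) (y : Q) : qpath (tgt a) y -> qpath (src a) y.

Fixpoint qcat (Q : quiver) (x y z : Q) (p : qpath x y) : qpath y z -> qpath x z :=
  match p with
  | qnil _ => id
  | qcons a _ p' => fun q => qcons (qcat p' q)
  end.

Definition qarrow (Q : quiver) (a : arr Q) : qpath (src a) (tgt a) :=
  qcons (qnil (tgt a)).

Section QuiverTheory.
Variable Q : quiver.
Implicit Types x y : Q.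

(* A traversal [(a, b)] of the underlying undirected multigraph follows the
   edge [a] along its orientation if [b], and against it otherwise. *)
Definition trav_start (e : arr Q * bool) : Q := if e.2 then src e.1 else tgt e.1.
Definition trav_end (e : arr Q * bool) : Q := if e.2 then tgt e.1 else src e.1.

Definition adjacent x y := [exists e, (trav_start e == x) && (trav_end e == y)].

(* Loops and pairs of parallel edges are cycles. *)
Definition undirected_cycle (c : seq (arr Q * bool)) : bool :=
  [&& c != [::], cycle (fun e e' => trav_end e == trav_start e') c,
      uniq (map trav_start c) & uniq (map fst c)].

Definition tree_quiver : Prop :=
  [/\ (0 < #|Q|)%N, forall x y, connect adjacent x y
    & forall c, ~~ undirected_cycle c].

Definition out_degree x := #|[pred a : arr Q | src a == x]|.

Definition is_root x : bool := (out_degree x == 0)%N.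

Definition rooted_tree_quiver : Prop := tree_quiver /\ exists! s, is_root s.

Definition arrow_rel x y := [exists a : arr Q, (src a == x) && (tgt a == y)].

Definition leQ x y : bool := connect arrow_rel x y.

Lemma leQP x y : reflect (inhabited (qpath x y)) (leQ x y).
Proof.
apply: (iffP connectP) => [[p]|[]].
  elim: p x => [|z p IHp] x /=; first by move=> _ ->; exists; exact: qnil.
  move=> /andP[/existsP[a /andP[/eqP <- /eqP <-]]] /IHp{IHp}IHp /IHp[q].
  by exists; exact: qcons.
elim=> {x y} [x|a y _ [p p_path ->]]; first by exists [::].
exists (tgt a :: p) => //=; rewrite p_path andbT.
by apply/existsP; exists a; rewrite !eqxx.
Qed.

Variable x : Q.

(* The full subquiver of [Q] on the vertices [y] with [y <=_Q x]. *)
Definition down_vert := {y : Q | leQ y x}.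
Definition down_arr := {a : arr Q | leQ (src a) x && leQ (tgt a) x}.

Definition down_src (a : down_arr) : down_vert :=
  exist (fun y => leQ y x) (src (val a)) (proj1 (andP (valP a))).
Definition down_tgt (a : down_arr) : down_vert :=
  exist (fun y => leQ y x) (tgt (val a)) (proj2 (andP (valP a))).

Definition down : quiver := Quiver down_src down_tgt.

Definition down_incl : qmor down Q :=
  @QMor down Q val val (fun=> erefl) (fun=> erefl).

End QuiverTheory.

Lemma is_rootP (Q : quiver) (y : Q) :
  reflect (forall a : arr Q, src a <> y) (is_root y).
Proof.
apply: (iffP eqP) => [/card0_eq y0 a ay|noa].
  by have := y0 a; rewrite inE ay eqxx.
by apply: eq_card0 => a; rewrite inE; apply/eqP/noa.
Qed.

Lemma arrow_path (Q : quiver) (a : arr Q) (p : seq Q) :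
    path (@arrow_rel Q) (tgt a) p ->
  exists t : seq (arr Q), [/\ path (fun b b' => tgt b == src b') a t,
    map src t = belast (tgt a) p & tgt (last a t) = last (tgt a) p].
Proof.
elim: p a => [|y p IHp] a /=; first by exists [::].
move=> /andP[/existsP[b /andP[/eqP ba /eqP <-]]] /IHp[t [t_path t_src t_last]].
by exists (b :: t); rewrite /= ba eqxx t_src.
Qed.

Lemma tree_no_return (Q : quiver) (a : arr Q) :
  tree_quiver Q -> ~~ leQ (tgt a) (src a).
Proof.
case=> _ _ acyc; apply/negP => /connectP[p].
case/shortenP=> {}p /arrow_path[t [t_path t_src t_last]] p_uniq _ p_last.
have /negP := acyc [seq (b, true) | b <- a :: t]; apply.
have at_uniq : uniq (map src (a :: t)).
  by rewrite /= t_src p_last -rcons_uniq -lastI.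
have a_cycle : cycle (fun b b' => tgt b == src b') (a :: t).
  by rewrite /= rcons_path t_path t_last -p_last eqxx.
rewrite /undirected_cycle cycle_map a_cycle -!map_comp at_uniq.
by rewrite map_id (map_uniq at_uniq).
Qed.

Lemma down_rooted_tree (Q : quiver) (x : Q) :
    rooted_tree_quiver Q -> rooted_tree_quiver (down x) /\
  (forall y : down x, is_root y <-> val y = x).
Proof.
move=> [Qtree _]; have [_ _ acyc] := Qtree.
have le_xx : leQ x x by exact: connect0.
pose x' : down x := exist (fun y => leQ y x) x le_xx.
have rootE (y : down x) : is_root y <-> val y = x.
  split=> [/is_rootP y_root|yx]; last first.
    apply/is_rootP => a ay; have := tree_no_return (val a) Qtree.
    have -> : src (val a) = x by exact: etrans (congr1 val ay) yx.
    by have /andP[_ ->] := valP a.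
  have first_step (u z : Q) : qpath u z ->
      u = z \/ exists2 a, src a = u & leQ (tgt a) z.
    by case=> [|a v p]; [left|right; exists a => //; apply/leQP].
  have /leQP[p] := valP y; case: (first_step _ _ p) => // -[a ay ax].
  have a_le : leQ (src a) x && leQ (tgt a) x by rewrite ax ay (valP y).
  by case: (y_root (exist _ a a_le)); apply: val_inj.
split=> //; split; last first.
  exists x'; split; first exact/rootE.
  by move=> y /rootE yx; apply: val_inj.
split; first by apply/card_gt0P; exists x'.
- have adj y z (p : qpath y z) (hy : leQ y x) (hz : leQ z x) :
      let y' : down x := exist (fun y => leQ y x) y hy in
      let z' : down x := exist (fun y => leQ y x) z hz in
    connect (@adjacent (down x)) y' z' /\ connect (@adjacent (down x)) z' y'.
    elim: p hy hz => {y z} [y|a z p IHp] hy hz.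
      by rewrite (bool_irrelevance hy hz); split; exact: connect0.
    have hm : leQ (tgt a) x by apply: connect_trans hz; apply/leQP.
    have hyx : leQ (src a) x && leQ (tgt a) x by rewrite hy.
    have [mz zm] := IHp hm hz; pose b : arr (down x) := exist _ a hyx.
    split; [apply: connect_trans mz|apply: (connect_trans zm)]; apply: connect1.
      by apply/existsP; exists (b, true); apply/andP; split; apply/eqP/val_inj.
    by apply/existsP; exists (b, false); apply/andP; split; apply/eqP/val_inj.
  have to_x (y : down x) : connect (@adjacent (down x)) y x' /\
                           connect (@adjacent (down x)) x' y.
    by case: y => y hy; have /leQP[p] := hy; exact: adj p hy le_xx.
  by move=> y z; apply: connect_trans (to_x y).1 (to_x z).2.
- move=> c; pose v (e : arr (down x) * bool) := (val e.1, e.2).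
  have vs e : trav_start (v e) = val (trav_start e) by case: e => a [].
  have ve e : trav_end (v e) = val (trav_end e) by case: e => a [].
  have := acyc (map v c); apply: contra => /and4P[c0 c_cyc c_start c_arr].
  apply/and4P; split.
  + by case: (c) c0.
  + rewrite cycle_map; apply: sub_cycle c_cyc => e e' /=.
    by rewrite vs ve => /eqP->.
  + have -> : map (@trav_start Q) (map v c) = map val (map (@trav_start (down x)) c).
      by rewrite -!map_comp; apply: eq_map => e /=.
    by rewrite (map_inj_uniq val_inj).
  + have -> : map fst (map v c) = map val (map fst c) by rewrite -!map_comp.
    by rewrite (map_inj_uniq val_inj).
Qed.

Section Representations.
Variable k : fieldType.

Record rep (Q : quiver) := Rep {
  rep_sp :> Q -> vectType k;
  rep_map : forall a : arr Q, 'Hom(rep_sp (src a), rep_sp (tgt a)) }.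

Section FixedQuiver.
Variable Q : quiver.
Implicit Types V W : rep Q.

Record rep_hom V W := RepHom {
  rep_hom_fun :> forall x, 'Hom(V x, W x);
  rep_hom_nat : forall a (v : V (src a)),
    rep_hom_fun (tgt a) (rep_map V a v) = rep_map W a (rep_hom_fun (src a) v) }.

Definition rep_iso V W : Prop :=
  exists (f : rep_hom V W) (g : rep_hom W V),
    (forall x, cancel (f x) (g x)) /\ (forall x, cancel (g x) (f x)).

Definition rep_zero V : Prop := forall x (v : V x), v = 0.

Definition rep_dsum (I : finType) (V : I -> rep Q) : rep Q :=
  @Rep Q (fun x => dsum (fun i => V i x))
    (fun a => \sum_i (dsum_in (fun i => V i (tgt a)) i \o
                      rep_map (V i) a \o
                      dsum_pr (fun i => V i (src a)) i)%VF).

Definition rep_dsum2 V W : rep Q := rep_dsum (fun b : bool => if b then V else W).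

Definition direct_summand W V : Prop := exists W', rep_iso V (rep_dsum2 W W').

(* Classes of objects, viewed as full subcategories of the category of
   representations. *)
Implicit Type A : rep Q -> Prop.

Definition additive_closure A (V : rep Q) : Prop :=
  exists (n : nat) (W : 'I_n -> rep Q),
    (forall i, exists2 U, A U & direct_summand (W i) U) /\ rep_iso V (rep_dsum W).

(* Indecomposable objects of the additive category [A]: the decompositions are
   those in [A], with the zero object excluded. *)
Definition indecomposable_in A (V : rep Q) : Prop :=
  [/\ A V, ~ rep_zero V
    & forall W W', A W -> A W' -> rep_iso V (rep_dsum2 W W') ->
        rep_zero W \/ rep_zero W'].

Definition finite_type A : Prop :=
  exists (n : nat) (F : 'I_n -> rep Q),
    forall V, indecomposable_in A V -> exists i, rep_iso V (F i).

End FixedQuiver.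

Section PushForward.
Variables (Q' Q : quiver) (f : qmor Q' Q) (V : rep Q').

Definition fiber0 (x : Q) := {y : Q' | f y == x}.
Definition fiber1 (a : arr Q) := {b : arr Q' | qmor1 f b == a}.

Definition push_sp (x : Q) : vectType k :=
  dsum (fun y : fiber0 x => V (val y)).

Fact fiber_src_subproof a (b : fiber1 a) : f (src (val b)) == src a.
Proof. by rewrite qmor_src (eqP (valP b)). Qed.
Fact fiber_tgt_subproof a (b : fiber1 a) : f (tgt (val b)) == tgt a.
Proof. by rewrite qmor_tgt (eqP (valP b)). Qed.

Definition fiber_src a (b : fiber1 a) : fiber0 (src a) :=
  exist (fun y => f y == src a) (src (val b)) (fiber_src_subproof b).
Definition fiber_tgt a (b : fiber1 a) : fiber0 (tgt a) :=
  exist (fun y => f y == tgt a) (tgt (val b)) (fiber_tgt_subproof b).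

Definition push_forward : rep Q :=
  @Rep Q push_sp
    (fun a => \sum_(b : fiber1 a)
      (dsum_in (fun y : fiber0 (tgt a) => V (val y)) (fiber_tgt b) \o
       rep_map V (val b) \o
       dsum_pr (fun y : fiber0 (src a) => V (val y)) (fiber_src b))%VF).

End PushForward.

Definition rep_const (Q : quiver) : rep Q :=
  @Rep Q (fun=> k^o) (fun=> \1%VF).

(* When [B] is a rooted tree quiver, [rto_root] says that the root of the tree is
   sent to the root of [B]; see [down_rooted_tree] for [B := down x]. *)
Record rooted_tree_over (B : quiver) := RootedTreeOver {
  rto_quiver :> quiver;
  rto_mor : qmor rto_quiver B;
  rto_tree : rooted_tree_quiver rto_quiver;
  rto_root : forall r, is_root r -> is_root (rto_mor r) }.

Record rto_hom (B : quiver) (S T : rooted_tree_over B) := RtoHom {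
  rto_hom_mor :> qmor S T;
  rto_hom_root : forall r, is_root r -> is_root (rto_hom_mor r);
  rto_hom_over0 : forall y, rto_mor T (rto_hom_mor y) = rto_mor S y;
  rto_hom_over1 : forall b,
    qmor1 (rto_mor T) (qmor1 rto_hom_mor b) = qmor1 (rto_mor S) b }.

Definition reduced (B : quiver) (T : rooted_tree_over B) : Prop :=
  forall g : rto_hom T T, g =1 id /\ qmor1 g =1 id.

Definition linearization (B : quiver) (T : rooted_tree_over B) : rep B :=
  push_forward (rto_mor T) (rep_const T).

Definition reduced_rooted_tree_module (Q : quiver) (V : rep Q) : Prop :=
  exists (x : Q) (T : rooted_tree_over (down x)),
    reduced T /\ rep_iso V (push_forward (down_incl x) (linearization T)).

Variable R : realType.

Record top_diagram (Q : quiver) := TopDiagram {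
  td_sp :> Q -> fintop R;
  td_map : forall x y, qpath x y -> continuousType (td_sp x) (td_sp y);
  td_id : forall x, td_map (qnil x) =1 id;
  td_comp : forall x y z (p : qpath x y) (q : qpath y z),
    td_map (qcat p q) =1 td_map q \o td_map p }.

(* A functor on the path category is determined by its values on arrows, hence
   the restriction of [H0] to the paths of length one. *)
Definition H0_rep (Q : quiver) (X : top_diagram Q) : rep Q :=
  @Rep Q (fun x => H0_fin k (X x)) (fun a => H0_fin_map k (td_map X (qarrow a))).

(* The essential image of [H0_rep]. *)
Definition rep_H0 (Q : quiver) (V : rep Q) : Prop :=
  exists X : top_diagram Q, rep_iso V (H0_rep X).

End Representations.

Arguments rep_H0 k R {Q} V.

(* Main.v *)
Require Import Defs.
From HB Require Import structures.
From mathcomp Require Import all_boot all_order all_algebra.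
From mathcomp Require Import boolp classical_sets functions cardinality.
From mathcomp Require Import reals topology normedtype.

(** Since every vertex of [Q] but the root has exactly one outgoing arrow, a
    diagram of spaces has as [pi_0] a forest over [Q], and [H0] is its
    linearization. Conversely a forest over [Q] with partial parent map becomes
    total, up to a direct summand, after attaching its roots to a copy of [Q].
    So the additive closure consists of the retracts of linearized forests.

    If the tree below a vertex [v] maps to the tree below a sibling of [v], then
    the edge above [v] can be cut without changing the linearization. Iterating,
    every linearized forest becomes that of a forest in which no such map exists
    (an antichain forest), i.e. a direct sum over its trees, which are exactly
    the reduced ones.

    Let [f] be an idempotent endomorphism of the linearization of a reduced tree,
    acting by [0] at the root (otherwise replace [f] by [1 - f]). If [w] occurs in
    [f u], the tree below [u] maps to the tree below [w]; if [f] kills the parent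
    of [u], coefficients cancel over siblings of [w], so another sibling occurs as
    well and the tree below [w] cannot map back. Hence [f] is nilpotent on each
    fibre in turn, thus zero. Fitting's lemma and the Krull-Schmidt argument
    conclude.

    Siblings of a reduced tree have distinct isomorphism types, which bounds the
    number of its vertices. *)

Set Implicit Arguments.
Unset Strict Implicit.
Unset Printing Implicit Defensive.

Import Order.TTheory GRing.Theory Num.Theory.
Import numFieldNormedType.Exports.
Local Open Scope ring_scope.

(** * Representations and Fitting's lemma *)

Section RepCategory.
Variables (k : fieldType) (Q : quiver).
Implicit Types (U V W : rep k Q).

Definition rh_id V : rep_hom V V.
Proof. by exists (fun x => \1%VF) => a v; rewrite !id_lfunE. Defined.

Definition rh_comp U V W (g : rep_hom V W) (f : rep_hom U V) : rep_hom U W.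
Proof.
by exists (fun x => (g x \o f x)%VF) => a v; rewrite !comp_lfunE !rep_hom_nat.
Defined.

Definition rh_sub V W (f g : rep_hom V W) : rep_hom V W.
Proof.
exists (fun x => f x - g x) => a v.
by rewrite !add_lfunE !opp_lfunE !rep_hom_nat linearB.
Defined.

Definition rh_sum V W (I : Type) (r : seq I) (f : I -> rep_hom V W) : rep_hom V W.
Proof.
exists (fun x => \sum_(i <- r) f i x) => a v.
by rewrite !sum_lfunE linear_sum; apply: eq_bigr => i _; rewrite rep_hom_nat.
Defined.

Definition rh_iter V (f : rep_hom V V) n : rep_hom V V :=
  iter n (rh_comp f) (rh_id V).

Lemma rh_idE V x (v : V x) : rh_id V x v = v.
Proof. exact: id_lfunE. Qed.

Lemma rh_compE U V W (g : rep_hom V W) (f : rep_hom U V) x v :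
  rh_comp g f x v = g x (f x v).
Proof. exact: comp_lfunE. Qed.

Lemma rh_subE V W (f g : rep_hom V W) x v : rh_sub f g x v = f x v - g x v.
Proof. by rewrite /rh_sub /= add_lfunE opp_lfunE. Qed.

Lemma rh_sumE V W (I : Type) (r : seq I) (f : I -> rep_hom V W) x v :
  rh_sum r f x v = \sum_(i <- r) f i x v.
Proof. exact: sum_lfunE. Qed.

Lemma rh_iterE V (f : rep_hom V V) n x v : rh_iter f n x v = iter n (f x) v.
Proof.
by rewrite /rh_iter; elim: n => [|n IHn] /=; rewrite ?rh_idE // rh_compE IHn.
Qed.

Definition retract V W : Prop :=
  exists (i : rep_hom V W) (p : rep_hom W V), forall x, cancel (i x) (p x).

Lemma retract_trans U V W : retract U V -> retract V W -> retract U W.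
Proof.
move=> [i [p ip]] [j [q jq]]; exists (rh_comp j i), (rh_comp p q) => x v.
by rewrite !rh_compE jq ip.
Qed.

Lemma rep_iso_retract V W : rep_iso V W -> retract V W.
Proof. by move=> [f [g [fg _]]]; exists f, g. Qed.

Lemma rep_iso_sym V W : rep_iso V W -> rep_iso W V.
Proof. by move=> [f [g [fg gf]]]; exists g, f. Qed.

Lemma rep_iso_refl V : rep_iso V V.
Proof. by exists (rh_id V), (rh_id V); split=> x v; rewrite !rh_idE. Qed.

Lemma rep_iso_trans U V W : rep_iso U V -> rep_iso V W -> rep_iso U W.
Proof.
move=> [f [g [fg gf]]] [f' [g' [fg' gf']]].
by exists (rh_comp f' f), (rh_comp g g'); split=> x v; rewrite !rh_compE ?fg' ?fg ?gf ?gf'.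
Qed.

(** A vertexwise bijective homomorphism has a linear inverse at each vertex, and these inverses are
    natural. So [g] may be a family of plain functions, whose linearity and naturality come for
    free. *)
Lemma rep_iso_bij V W (f : rep_hom V W) (g : forall x, W x -> V x) :
    (forall x, cancel (f x) (g x)) -> (forall x, cancel (g x) (f x)) ->
  rep_iso V W.
Proof.
move=> fg gf; have f0 x : lker (f x) == 0%VS by apply/lker0P/can_inj/fg.
have fK x : cancel (f x)^-1%VF (f x).
  by move=> w; rewrite -(gf x w) lker0_lfunK.
have gnat a (w : W (src a)) :
    (f (tgt a))^-1%VF (rep_map W a w) = rep_map V a ((f (src a))^-1%VF w).
  by rewrite -{1}(fK _ w) -rep_hom_nat lker0_lfunK.
exists f, (@RepHom _ _ W V (fun x => (f x)^-1%VF) gnat); split=> x v /=; last exact: fK.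
by rewrite lker0_lfunK.
Qed.

Section DirectSum.
Variables (I : finType) (V : I -> rep k Q).

Lemma rep_dsum_mapE a (w : rep_dsum V (src a)) i :
  (rep_map (rep_dsum V) a w : dsum _) i = rep_map (V i) a ((w : dsum _) i).
Proof.
rewrite -[LHS](dsum_prE i) sum_lfunE linear_sum (bigD1 i) //= big1 => [|j ne_ji].
  by rewrite addr0 !comp_lfunE dsum_prE dsum_inE dfwith_in dsum_prE.
by rewrite !comp_lfunE dsum_prE dsum_inE dfwith_out // eq_sym.
Qed.

Definition rh_pr i : rep_hom (rep_dsum V) (V i).
Proof.
exists (fun x => dsum_pr (fun i => V i x) i) => a v.
by rewrite !dsum_prE rep_dsum_mapE.
Defined.

Definition rh_in i : rep_hom (V i) (rep_dsum V).
Proof.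
exists (fun x => dsum_in (fun i => V i x) i) => a v; apply/ffunP=> j.
rewrite rep_dsum_mapE !dsum_inE; case: (eqVneq i j) => [<-|ne_ij].
  by rewrite !dfwith_in.
by rewrite !dfwith_out ?linear0.
Defined.

Lemma rh_prE i x (w : rep_dsum V x) : rh_pr i x w = (w : dsum _) i.
Proof. exact: (dsum_prE (V := fun i => V i x)). Qed.

Lemma rh_pr_in i x (v : V i x) : rh_pr i x (rh_in i x v) = v.
Proof. by rewrite rh_prE /= dsum_inE dfwith_in. Qed.

Lemma rh_pr_in_ne i j x (v : V i x) : i != j -> rh_pr j x (rh_in i x v) = 0.
Proof. by move=> ij; rewrite rh_prE /= dsum_inE dfwith_out. Qed.

Lemma rh_in_pr x (w : rep_dsum V x) : \sum_i rh_in i x (rh_pr i x w) = w.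
Proof.
apply/ffunP=> j; rewrite -[LHS]rh_prE linear_sum (bigD1 j) //= big1 => [|i ne_ij].
  by rewrite addr0 (rh_pr_in (i := j)) rh_prE.
exact: (rh_pr_in_ne _ ne_ij).
Qed.

Definition rh_copair W (f : forall i, rep_hom (V i) W) : rep_hom (rep_dsum V) W :=
  rh_sum (index_enum I) (fun i => rh_comp (f i) (rh_pr i)).

Lemma rh_copairE W (f : forall i, rep_hom (V i) W) x w :
  rh_copair f x w = \sum_i f i x ((w : dsum _) i).
Proof. by rewrite rh_sumE; apply: eq_bigr => i _; rewrite rh_compE rh_prE. Qed.

End DirectSum.

Definition rh_copair2 U V W (f : rep_hom U W) (g : rep_hom V W) :
    rep_hom (rep_dsum2 U V) W :=
  rh_copair (fun b => if b return rep_hom (if b then U else V) W then f else g).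

Lemma rh_copair2E U V W (f : rep_hom U W) (g : rep_hom V W) x w :
  rh_copair2 f g x w = f x ((w : dsum _) true) + g x ((w : dsum _) false).
Proof. by rewrite rh_copairE big_bool. Qed.

Section SubRep.
Variables (V : rep k Q) (U : forall x, {vspace V x}).
Hypothesis stableU : forall a v, v \in U (src a) -> rep_map V a v \in U (tgt a).

Definition sub_rep : rep k Q := @Rep k Q (fun x => subvs_of (U x))
  (fun a => linfun (vsproj (U (tgt a))) \o rep_map V a \o linfun vsval)%VF.

Definition sub_incl : rep_hom sub_rep V.
Proof.
exists (fun x => linfun vsval) => a v.
rewrite !lfunE /= !comp_lfunE !lfunE /= vsprojK //.
exact/stableU/subvsP.
Defined.

Lemma sub_inclE x v : sub_incl x v = vsval v.
Proof. by rewrite lfunE. Qed.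

End SubRep.

Lemma rep_dsum2_iso U V W (f : rep_hom U W) (g : rep_hom V W)
    (a : forall x, W x -> U x) (b : forall x, W x -> V x) :
    (forall x w, f x (a x w) + g x (b x w) = w) ->
    (forall x u v, a x (f x u + g x v) = u /\ b x (f x u + g x v) = v) ->
  rep_iso W (rep_dsum2 U V).
Proof.
move=> abK fgK; apply: rep_iso_sym.
apply: (rep_iso_bij (f := rh_copair2 f g) (g := fun x w =>
  [ffun c => if c as c return (if c then U else V) x then a x w else b x w] : dsum _)) => x w.
  rewrite rh_copair2E; apply/ffunP => c; rewrite ffunE.
  by case: c; rewrite (fgK x _ _).1 || rewrite (fgK x _ _).2.
by rewrite rh_copair2E !ffunE abK.
Qed.

Lemma sub_rep_split V (U U' : forall x, {vspace V x})
    (sU : forall a v, v \in U (src a) -> rep_map V a v \in U (tgt a))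
    (sU' : forall a v, v \in U' (src a) -> rep_map V a v \in U' (tgt a)) :
    (forall x, U x :&: U' x = 0)%VS -> (forall x, U x + U' x = fullv)%VS ->
  rep_iso V (rep_dsum2 (sub_rep U) (sub_rep U')).
Proof.
move=> UI UD; apply: (rep_dsum2_iso (f := sub_incl sU) (g := sub_incl sU')
  (a := fun x v => vsproj (U x) (daddv_pi (U x) (U' x) v))
  (b := fun x v => vsproj (U' x) (daddv_pi (U' x) (U x) v))) => x.
  move=> w; rewrite !sub_inclE !vsprojK ?memv_pi //.
  by rewrite daddv_pi_add // UD memvf.
move=> u v; rewrite !sub_inclE; have UI' : (U' x :&: U x = 0)%VS by rewrite capvC.
have pi0 (X Y : {vspace V x}) w : (X :&: Y = 0)%VS -> w \in Y -> daddv_pi X Y w = 0.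
  move=> XY Yw; apply: (addIr (daddv_pi Y X w)).
  rewrite daddv_pi_add // ?(subvP (addvSr _ _)) // add0r daddv_pi_id //.
  by rewrite capvC.
split; apply: val_inj; rewrite /= vsprojK ?memv_pi // linearD /=.
  by rewrite daddv_pi_id ?subvsP // pi0 ?subvsP // addr0.
by rewrite pi0 ?subvsP // add0r daddv_pi_id ?subvsP.
Qed.

(** The complement is the kernel of [p], reached by the projection sending [w] to [w - i (p w)]. *)
Lemma retract_summand V W : retract V W -> direct_summand V W.
Proof.
move=> [i [p ip]].
have sK a v : v \in lker (p (src a)) -> rep_map W a v \in lker (p (tgt a)).
  by rewrite !memv_ker rep_hom_nat => /eqP->; rewrite linear0.
have inK x (w : W x) : w - i x (p x w) \in lker (p x).
  by rewrite memv_ker linearB /= ip subrr.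
exists (sub_rep (fun x => lker (p x))).
apply: (rep_dsum2_iso (f := i) (g := sub_incl sK) (a := fun x => p x)
  (b := fun x w => vsproj (lker (p x)) (w - i x (p x w)))) => x.
  by move=> w; rewrite sub_inclE vsprojK ?inK ?subrKC.
move=> u v; rewrite sub_inclE linearD /= ip.
have /eqP-> : p x (vsval v) == 0 by rewrite -memv_ker subvsP.
by rewrite addr0 addrC addKr vsvalK.
Qed.

Definition rep_inj V W (f : rep_hom V W) := forall x, injective (f x).

Definition rep_nilpotent V (f : rep_hom V V) :=
  exists n, forall x v, iter n (f x) v = 0.

(** A power [F] of [f] whose rank is minimal has complementary image and kernel; these are [W] and
    [W']. *)
Lemma fitting V (f : rep_hom V V) : exists W W',
  [/\ rep_iso V (rep_dsum2 W W'), rep_zero W -> rep_nilpotent f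
    & rep_zero W' -> rep_inj f].
Proof.
(* Ranks are summed over all vertices, so that one exponent serves everywhere. The exponent [n.+1]
   is positive, so that [F] kills whatever [f] kills. *)
pose rk n := (\sum_x \dim (limg (rh_iter f n.+1 x)))%N.
have [_ [n ->] n_min] : exists2 r, exists n, r = rk n & forall m, (r <= rk m)%N.
  have exr : exists r, [pred r | `[< exists n, r = rk n >]] r.
    by exists (rk 0%N); apply/asboolP; exists 0%N.
  case: (ex_minnP exr) => r /asboolP[n rn] rmin; exists r; first by exists n.
  by move=> m; apply: rmin; apply/asboolP; exists m.
pose F := rh_iter f n.+1.
have FE x v : F x v = iter n.+1 (f x) v by exact: rh_iterE.
have sF a v : v \in limg (F (src a)) -> rep_map V a v \in limg (F (tgt a)).
  by case/memv_imgP => u _ ->; rewrite -rep_hom_nat memv_img // memvf.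
have sK a v : v \in lker (F (src a)) -> rep_map V a v \in lker (F (tgt a)).
  by rewrite !memv_ker rep_hom_nat => /eqP->; rewrite linear0.
have FF x : limg (rh_iter f (n + n.+1).+1 x) = (F x @: limg (F x))%VS.
  rewrite -limg_comp; congr lfun_img; apply/lfunP => v.
  by rewrite rh_iterE comp_lfunE !FE -iterD addSn.
have FFle x : (\dim (F x @: limg (F x)) <= \dim (limg (F x)))%N.
  by rewrite -[in X in (_ <= X)%N](limg_ker_dim (F x) (limg (F x))) leq_addl.
(* No rank can grow from [F] to its square, so a drop at one vertex would make the sum drop below
   its minimum. *)
have dimFF x : \dim (F x @: limg (F x)) = \dim (limg (F x)).
  apply/eqP; rewrite eqn_leq FFle /= leqNgt; apply/negP => ltx.
  have := n_min (n + n.+1)%N; rewrite /rk leqNgt => /negP; apply.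
  rewrite (bigD1 x) //= [in X in (_ < X)%N](bigD1 x) //= FF.
  rewrite -addSn leq_add // leq_sum // => y _; rewrite FF; exact: FFle.
have cap0 x : (limg (F x) :&: lker (F x) = 0)%VS.
  apply/eqP; rewrite -dimv_eq0 -(eqn_add2r (\dim (F x @: limg (F x)))).
  by rewrite limg_ker_dim add0n dimFF.
have sum1 x : (limg (F x) + lker (F x) = fullv)%VS.
  apply/eqP; rewrite eqEdim subvf /= dimv_disjoint_sum // addnC.
  by rewrite -(limg_ker_dim (F x) fullv) capfv.
exists (sub_rep (fun x => limg (F x))), (sub_rep (fun x => lker (F x))); split.
- exact: sub_rep_split.
- move=> z; exists n.+1 => x v; rewrite -FE.
  have vF : F x v \in limg (F x) by rewrite memv_img ?memvf.
  by have := congr1 vsval (z x (vsproj _ (F x v))); rewrite /= vsprojK.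
- move=> z x; apply/lker0P/eqP/vspaceP => v; rewrite memv0.
  apply/idP/eqP => [|->]; last exact: mem0v.
  rewrite memv_ker => /eqP fv; have vK : v \in lker (F x).
    by rewrite memv_ker FE iterSr fv; elim: (n) => //= m /eqP->; rewrite linear0.
  by have := congr1 vsval (z x (vsproj _ v)); rewrite /= vsprojK.
Qed.

(** Fitting's alternative, standing for a local endomorphism ring: in finite dimension an injective
    endomorphism is invertible, see [rep_inj_inv]. *)
Definition local_rep V := forall f : rep_hom V V, rep_inj f \/ rep_nilpotent f.

Lemma rep_inj_inv V (f : rep_hom V V) : rep_inj f ->
  exists g : rep_hom V V, forall x, cancel (f x) (g x) /\ cancel (g x) (f x).
Proof.
move=> fI; have f0 x : lker (f x) == 0%VS by exact/lker0P.
have [h [g [hg gh]]] : rep_iso V V.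
  apply: (rep_iso_bij (f := f) (g := fun x => (f x)^-1%VF)) => x v.
    exact: lker0_lfunK.
  exact: lker0_lfunVK.
have gnat a (v : V (src a)) :
    (f (tgt a))^-1%VF (rep_map V a v) = rep_map V a ((f (src a))^-1%VF v).
  by rewrite -{1}(lker0_lfunVK (f0 _) v) -rep_hom_nat lker0_lfunK.
exists (@RepHom _ _ V V (fun x => (f x)^-1%VF) gnat) => x; split=> v /=.
  exact: lker0_lfunK.
exact: lker0_lfunVK.
Qed.

(** Let [g] be the inverse of the sum. If [g] composed with the first term is injective, so is this
    term. If it is nilpotent, then it fixes every vector killed by the remaining terms, so such a
    vector is zero and the remaining sum is injective. *)
Lemma local_rep_sum V (I : Type) (r : seq I) (f : I -> rep_hom V V) :
  local_rep V -> ~ rep_zero V -> rep_inj (rh_sum r f) -> exists i, rep_inj (f i).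
Proof.
move=> Vloc V0; elim: r => [|i r IHr] sI.
  case: V0 => x v; apply: (sI x); by rewrite !rh_sumE !big_nil.
have [g gK] := rep_inj_inv sI.
case: (Vloc (rh_comp g (f i))) => [gfI|[n gf0]].
  by exists i => x v w fvw; apply: (gfI x); rewrite !rh_compE fvw.
apply: IHr => x; apply/lker0P/eqP/vspaceP => v; rewrite memv0.
apply/idP/eqP => [|->]; last exact: mem0v.
rewrite memv_ker rh_sumE => /eqP rv.
have gfv : g x (f i x v) = v.
  by have := (gK x).1 v; rewrite rh_sumE big_cons rv addr0.
have <- := gf0 x v; elim: (n) => //= m <-.
by rewrite rh_compE gfv.
Qed.

End RepCategory.

(** * Arrows of a rooted tree quiver *)

Section RootedTreeQuiver.
Variable Q : quiver.
Hypothesis HQ : rooted_tree_quiver Q.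

(** This drops along every arrow, so inductions towards the root run on it. It counts [y] itself,
    hence is positive, and the case of height 0 is vacuous. *)
Definition height (y : Q) : nat := #|[pred z | leQ y z]|.

Lemma leQ_arrow (a : arr Q) : leQ (src a) (tgt a).
Proof. by apply: connect1; apply/existsP; exists a; rewrite !eqxx. Qed.

Lemma height_arrow (a : arr Q) : (height (tgt a) < height (src a))%N.
Proof.
apply/proper_card/properP; split.
  by apply/fintype.subsetP => z; rewrite !inE; apply: connect_trans (leQ_arrow a).
exists (src a); rewrite inE.
  exact: connect0.
exact: (tree_no_return a HQ.1).
Qed.

Lemma height_le (y : Q) : (height y <= #|Q|)%N.
Proof. exact: max_card. Qed.

Lemma leQ_root (s y : Q) : is_root s -> leQ y s.
Proof.
have [x [rx ux]] := HQ.2 => rs; rewrite -(ux _ rs) {s rs}.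
have [n] := ubnP (height y); elim: n y => // n IHn y.
rewrite ltnS => le_yn; case: (pickP [pred a : arr Q | src a == y]) => [a /eqP ay|noa].
  subst y; apply: connect_trans (leQ_arrow a) (IHn _ _).
  exact: leq_trans (height_arrow a) le_yn.
rewrite (ux y); first exact: connect0.
apply/is_rootP => a ay.
by have := noa a; rewrite /= ay eqxx.
Qed.

Local Notation link := (fun e e' : arr Q => tgt e == src e').

Lemma link_leQ (a : arr Q) t e : path link a t -> e \in t -> leQ (tgt a) (src e).
Proof.
elim: t a => //= b t IHt a /andP[/eqP ab bt]; rewrite inE => /predU1P[->|et].
  by rewrite ab; exact: connect0.
by rewrite ab; apply: connect_trans (leQ_arrow b) (IHt _ bt et).
Qed.

Lemma link_uniq (a : arr Q) t : path link a t ->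
  uniq (map src (a :: t)) /\ uniq (map tgt (a :: t)).
Proof.
elim: t a => [|b t IHt] a; first by [].
rewrite [path _ _ _]/= => /andP[/eqP ab bt].
have abt : path link a (b :: t) by rewrite /= ab eqxx.
have [us ut] := IHt _ bt; rewrite (map_cons src a) (map_cons tgt a).
rewrite (cons_uniq (src a)) (cons_uniq (tgt a)) us ut !andbT.
split; apply/mapP => -[e et ae]; have := link_leQ abt et.
  by rewrite -ae; apply/negP/(tree_no_return _ HQ.1).
by rewrite ae; apply/negP/(tree_no_return _ HQ.1).
Qed.

(* Two arrows out of the same vertex continue to the root; the shortest pair of
   continuations with a common end point closes up to a cycle. *)
Lemma rooted_tree_arrow_inj (a b : arr Q) : src a = src b -> a = b.
Proof.
move=> ab; apply/eqP/negPn/negP => ne_ab; have [r [rr _]] := HQ.2.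
have to_root (e : arr Q) : exists2 t, path link e t & tgt (last e t) = r.
  have /connectP[p /arrow_path[t [tp _ tl]] pr] := leQ_root (tgt e) rr.
  by exists t; rewrite // tl pr.
have exm : exists m, [pred m | `[< exists t t', [/\ path link a t, path link b t',
    tgt (last a t) = tgt (last b t') & (size t + size t')%N = m] >]] m.
  have [t tp tr] := to_root a; have [t' tp' tr'] := to_root b.
  by exists (size t + size t')%N; apply/asboolP; exists t, t'; rewrite tr tr'.
case: (ex_minnP exm) => m /asboolP[t [t' [tp tp' tt' sz]]] min.
have shorter (u u' : seq (arr Q)) : path link a u -> path link b u' ->
    tgt (last a u) = tgt (last b u') -> (size t + size t' <= size u + size u')%N.
  by move=> up up' uu'; rewrite sz; apply: min; apply/asboolP; exists u, u'.
(* Cutting the two continuations after [e] and [e'] gives another pair with a common end point, so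
   by minimality nothing is cut off. *)
have meet e e' : e \in a :: t -> e' \in b :: t' -> tgt e = tgt e' ->
    e = last a t /\ e' = last b t'.
  have cut c (s : seq (arr Q)) g : path link c s -> g \in c :: s ->
      exists u, [/\ path link c u, last c u = g & (size u < size s)%N \/ u = s].
    move=> sp; rewrite inE => /predU1P[->|].
      by exists [::]; split=> //; case: (s) => [|? ?]; [right|left].
    move=> gs; case/splitPr: gs sp => s1 s2 sp; exists (rcons s1 g).
    rewrite last_rcons; split=> //.
      by move: sp; rewrite -cat_rcons cat_path => /andP[].
    rewrite size_cat size_rcons /= addnS; case: s2 sp => [|h s2] _.
      by right; rewrite cats1.
    by left; rewrite ltnS /= addnS ltnS leq_addr.
  move=> /(cut _ _ _ tp)[u [up <- us]] /(cut _ _ _ tp')[u' [up' <- us']] uu'.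
  have := shorter _ _ up up' uu'.
  case: us us' => [us|->] [us'|->] //; rewrite leqNgt ?ltn_add2l ?ltn_add2r ?us ?us' //.
  by rewrite -addSn leq_add // ltnW.
have [[us ut] [us' ut']] := (link_uniq tp, link_uniq tp').
have not_src_a (e : arr Q) : e \in a :: t -> tgt e <> src a.
  rewrite inE => /predU1P[->|et] ea; have := tree_no_return a HQ.1.
    by rewrite ea => /negP; apply; exact: connect0.
  by rewrite -ea => /negP; apply; apply: connect_trans (link_leQ tp et) (leQ_arrow e).
have not_src_b (e : arr Q) : e \in b :: t' -> tgt e <> src a.
  rewrite ab inE => /predU1P[->|et] ea; have := tree_no_return b HQ.1.
    by rewrite ea => /negP; apply; exact: connect0.
  by rewrite -ea => /negP; apply; apply: connect_trans (link_leQ tp' et) (leQ_arrow e).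
have pred_in c (s : seq (arr Q)) e : path link c s -> e \in s ->
    exists2 g, g \in belast c s & tgt g = src e.
  elim: s c => //= h s IHs c /andP[/eqP ch hs]; rewrite inE => /predU1P[->|es].
    by exists c; rewrite ?mem_head.
  by have [g gs ge] := IHs _ hs es; exists g => //; rewrite inE gs orbT.
have last_belast c (s : seq (arr Q)) : uniq (map src (c :: s)) -> last c s \notin belast c s.
  by move=> /map_uniq; rewrite lastI rcons_uniq => /andP[].
(* The traversals of the cycle start at the sources along [a :: t] and at the targets along
   [b :: t']. If these met at an [e] other than [a], then by [meet] the arrow before [e] would be
   the last one of [a :: t]. *)
have disj e e' : e \in a :: t -> e' \in b :: t' -> src e <> tgt e'.
  rewrite inE => /predU1P[->|et] e't ee'; first exact: (not_src_b _ e't).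
  have [g gt ge] := pred_in _ _ _ tp et.
  have [] := meet g e' (mem_belast gt) e't _; first by rewrite ge.
  by move=> gl; move: gt; rewrite gl (negPf (last_belast _ _ us)).
have ne_e e e' : e \in a :: t -> e' \in b :: t' -> e <> e'.
  move=> + + ee'; rewrite -{e'}ee' !inE => /predU1P[->|et] /predU1P[|et'].
  - exact/eqP.
  - have [g /mem_belast gt ge] := pred_in _ _ _ tp' et'.
    exact: (not_src_b _ gt).
  - move=> eb; have [g /mem_belast gt ge] := pred_in _ _ _ tp et.
    by apply: (not_src_a _ gt); rewrite ge eb ab.
  have [g gt ge] := pred_in _ _ _ tp et; have [g' gt' ge'] := pred_in _ _ _ tp' et'.
  have [] := meet g g' (mem_belast gt) (mem_belast gt') _; first by rewrite ge ge'.
  by move=> gl; move: gt; rewrite gl (negPf (last_belast _ _ us)).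
have Es (s : seq (arr Q)) : (map (@trav_start Q) [seq (e, true) | e <- s] = map src s) *
    (map (@trav_start Q) [seq (e, false) | e <- s] = map tgt s).
  by rewrite -!map_comp.
have Ef d (s : seq (arr Q)) : map fst [seq (e, d : bool) | e <- s] = s.
  by rewrite -map_comp map_id.
(* The cycle follows [a :: t] forwards and then [b :: t'] backwards. *)
have [_ _ /(_ ([seq (e, true) | e <- a :: t] ++
  rev [seq (e, false) | e <- b :: t']))/negP] := HQ.1.
apply; apply/and4P; split=> //.
- have -> : [seq (e, false) | e <- b :: t'] =
      rcons (belast (b, false) [seq (e, false) | e <- t']) (last b t', false).
    by rewrite map_cons lastI (last_map (fun e => (e, false))).
  rewrite map_cons cat_cons [cycle _ _]/= rev_rcons rcons_path cat_path last_cat.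
  rewrite (last_map (fun e => (e, true))) path_map /=.
  apply/andP; split; first (apply/and3P; split).
  + exact: tp.
  + by rewrite /trav_end /trav_start /= tt'.
  + rewrite -[(last b t', false)](last_map (fun e => (e, false))) rev_path path_map.
    by apply: sub_path tp' => e e' /=; rewrite /trav_end /trav_start /= eq_sym.
  + case: (t') => [|h s] /=; first by rewrite /trav_end /trav_start /= ab.
    by rewrite rev_cons last_rcons /trav_end /trav_start /= ab.
- rewrite map_cat map_rev !Es cat_uniq rev_uniq us ut' andbT.
  apply/hasPn => x; rewrite mem_rev => /mapP[e' e't ->]; apply/mapP => -[e et ee'].
  by apply: (disj e e').
- rewrite map_cat map_rev !Ef cat_uniq rev_uniq (map_uniq us) (map_uniq us') andbT.
  apply/hasPn => x; rewrite mem_rev => e't; apply/negP => et.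
  exact: (ne_e x x).
Qed.

End RootedTreeQuiver.

(** * Linearized forests *)

(* A functor from the path category of [Q] to finite sets with partial maps,
   given by its category of elements. *)
Record forest (Q : quiver) := Forest {
  fvert :> finType;
  lab : fvert -> Q;
  par : fvert -> option fvert }.
Arguments lab {Q f}. Arguments par {Q f}.

Definition forest_wf (Q : quiver) (P : forest Q) := forall s t : P,
  par s = Some t -> exists2 a : arr Q, src a = lab s & tgt a = lab t.

Section ForestRep.
Variables (k : fieldType) (Q : quiver).
Implicit Types (P : forest Q) (y : Q).

Definition fib P y := {s : P | lab s == y}.
Definition frep_sp P y : vectType k := {ffun fib P y -> k^o}.

(* [bvec y s] and [cf w v] are [0] for [s] and [w] outside the fibre over [y]. *)
Definition bvec P y (s : P) : frep_sp P y := [ffun u => (val u == s)%:R].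

Definition cf P y (w : P) (v : frep_sp P y) : k :=
  if insub w : option (fib P y) is Some u then (v : {ffun _}) u else 0.

Fact cf_is_linear P y w : linear (@cf P y w : _ -> k^o).
Proof.
move=> a u v; rewrite /cf; case: insub => [s|]; first by rewrite !ffunE.
by rewrite scaler0 addr0.
Qed.
HB.instance Definition _ P y w :=
  GRing.isLinear.Build k (frep_sp P y) k^o _ (@cf P y w) (@cf_is_linear P y w).

Lemma cf0 P y (w : P) : cf w (0 : frep_sp P y) = 0.
Proof. exact: linear0. Qed.

Lemma cfZ P y (w : P) a (v : frep_sp P y) : cf w (a *: v) = a * cf w v.
Proof. exact: linearZ. Qed.

Lemma cf_bvec P y (s w : P) : lab s = y -> cf w (bvec y s) = (w == s)%:R.
Proof.
move=> sy; rewrite /cf; case: insubP => [u _ <-|]; first by rewrite ffunE.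
by case: (eqVneq w s) => // ->; rewrite sy eqxx.
Qed.

Lemma cf_ext P y (u v : frep_sp P y) :
  (forall w, lab w = y -> cf w u = cf w v) -> u = v.
Proof.
move=> uv; apply/ffunP => s; have := uv (val s) (eqP (valP s)).
by rewrite /cf valK.
Qed.

Lemma cf_sum P y (v : frep_sp P y) : v = \sum_(s | lab s == y) cf s v *: bvec y s.
Proof.
apply: cf_ext => w wy; rewrite linear_sum (bigD1 w) ?wy //= big1.
  by rewrite addr0 linearZ /= cf_bvec // eqxx; rewrite [_ *: _]mulr1.
move=> s /andP[/eqP sy sw]; rewrite linearZ /= cf_bvec // eq_sym (negPf sw).
by rewrite scaler0.
Qed.

Definition lift_vec P y (M : lmodType k) (b : P -> M) (v : frep_sp P y) : M :=
  \sum_(s | lab s == y) cf s v *: b s.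

Fact lift_vec_linear P y (M : lmodType k) (b : P -> M) : linear (@lift_vec P y M b).
Proof.
move=> a u v; rewrite scaler_sumr -big_split; apply: eq_bigr => s _ /=.
by rewrite linearP scalerDl scalerA.
Qed.
HB.instance Definition _ P y (M : lmodType k) (b : P -> M) :=
  GRing.isLinear.Build k (frep_sp P y) M _ (@lift_vec P y M b)
    (@lift_vec_linear P y M b).

Lemma lift_vec_bvec P y (M : lmodType k) (b : P -> M) s :
  lab s = y -> lift_vec b (bvec y s) = b s.
Proof.
move=> sy; rewrite /lift_vec (bigD1 s) ?sy //= big1 ?addr0.
  by rewrite cf_bvec // eqxx scale1r.
by move=> t /andP[ty ts]; rewrite cf_bvec // (negPf ts) scale0r.
Qed.

Definition frep P : rep k Q := @Rep k Q (frep_sp P) (fun a =>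
  linfun (lift_vec (fun s : P => oapp (bvec (tgt a)) 0 (par s)))).

Lemma frep_map_bvec P a (s : P) : lab s = src a ->
  rep_map (frep P) a (bvec (src a) s) = oapp (bvec (tgt a)) 0 (par s).
Proof. by move=> sa; rewrite lfunE /= lift_vec_bvec. Qed.

Lemma frep_ext P y (M : vectType k) (f g : 'Hom(frep P y, M)) :
  (forall s, lab s = y -> f (bvec y s) = g (bvec y s)) -> f =1 g.
Proof.
move=> fg v; rewrite (cf_sum v) !linear_sum; apply: eq_bigr => s /eqP sy.
by rewrite !linearZ /= fg.
Qed.

Lemma cf_apply P y (f : 'Hom(frep P y, frep P y)) (v : frep_sp P y) w :
  cf w (f v : frep_sp P y) =
  \sum_(s | lab s == y) cf s v * cf w (f (bvec y s) : frep_sp P y).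
Proof.
rewrite {1}[v]cf_sum linear_sum [LHS](linear_sum (@cf P y w)).
by apply: eq_bigr => s _; rewrite linearZ [LHS](linearZ_LR (@cf P y w)).
Qed.

Lemma bvec_neq0 P y (s : P) : lab s = y -> bvec y s != 0.
Proof.
move=> sy; apply/eqP => s0; have /eqP := congr1 (cf s) s0.
by rewrite cf_bvec // eqxx linear0 oner_eq0.
Qed.

Section Lift.
Hypothesis HQ : rooted_tree_quiver Q.

Lemma lab_par P (s t : P) a :
  forest_wf P -> par s = Some t -> lab s = src a -> lab t = tgt a.
Proof. by move=> wP /wP[b <- <-] /(rooted_tree_arrow_inj HQ)->. Qed.

(** The universal property of [frep P]. The family [b] is indexed by all pairs of [y] and [s] to
    avoid transport along labels; only its values at [y = lab s] matter. *)
Lemma frep_lift P (W : rep k Q) (b : forall y, P -> W y) : forest_wf P ->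
    (forall a s, lab s = src a ->
      rep_map W a (b (src a) s) = oapp (b (tgt a)) 0 (par s)) ->
  exists f : rep_hom (frep P) W, forall s y, lab s = y -> f y (bvec y s) = b y s.
Proof.
move=> wP bnat; pose f y : 'Hom(frep P y, W y) := linfun (lift_vec (b y)).
have fE s y : lab s = y -> f y (bvec y s) = b y s.
  by move=> sy; rewrite lfunE /= lift_vec_bvec.
have fnat a v : f (tgt a) (rep_map (frep P) a v) = rep_map W a (f (src a) v).
  rewrite -[LHS]comp_lfunE -[RHS]comp_lfunE; move: v; apply: frep_ext => s sa.
  rewrite !comp_lfunE frep_map_bvec // fE // bnat //.
  case Es: (par s) => [t|] /=; last by rewrite linear0.
  exact/fE/(lab_par wP Es).
by exists (RepHom fnat).
Qed.

(** The sum runs over the children of [q]; when the left side vanishes, coefficients have to cancel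
    among siblings. *)
Lemma cf_frep_map P a (q : P) (v : frep P (src a)) : forest_wf P -> lab q = tgt a ->
  cf q (rep_map (frep P) a v) = \sum_(w | (lab w == src a) && (par w == Some q)) cf w v.
Proof.
move=> wP qa; rewrite {1}(cf_sum v) !linear_sum big_mkcondr.
apply: eq_bigr => s /eqP sa; rewrite !linearZ /= frep_map_bvec //.
case Es: (par s) => [t|] /=; last by rewrite linear0 [_ *: _]mulr0.
rewrite cf_bvec; last exact: lab_par wP Es sa.
rewrite (inj_eq Some_inj) eq_sym; case: eqP => _; first exact: mulr1.
exact: mulr0.
Qed.

(** The coordinates [co] are given vertex by vertex. Being injective and left inverse to the
    homomorphism that [frep_lift] builds from [b], they are its inverse, and [rep_iso_bij] takes
    care of naturality. *)
Lemma frep_iso P (W : rep k Q) (b : forall y, P -> W y)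
    (co : forall y, {linear W y -> frep_sp P y}) : forest_wf P ->
    (forall a s, lab s = src a ->
      rep_map W a (b (src a) s) = oapp (b (tgt a)) 0 (par s)) ->
    (forall y s, lab s = y -> co y (b y s) = bvec y s) ->
    (forall y, injective (co y)) ->
  rep_iso W (frep P).
Proof.
move=> wP bnat cob coI; have [f fE] := frep_lift wP bnat.
have cof y (v : frep P y) : co y (f y v) = v.
  rewrite (cf_sum v) !linear_sum; apply: eq_bigr => s /eqP sy.
  by rewrite !linearZ /= fE // cob.
apply/rep_iso_sym/(rep_iso_bij (f := f) (g := fun y => co y)) => y v.
  exact: cof.
by apply: (coI y); rewrite cof.
Qed.

End Lift.
End ForestRep.

(** * Cutting edges *)

Section Simulation.
Variable Q : quiver.
Implicit Types P : forest Q.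

Definition simulation P (R : P -> P -> Prop) := forall u w, R u w ->
  lab u = lab w /\
  forall u', par u' = Some u -> exists2 w', par w' = Some w & R u' w'.

(* [sim u w] iff the tree below [u] maps to the tree below [w]. *)
Definition sim P (u w : P) := exists2 R, simulation R & R u w.

Definition antichain P := forall v v' t : P,
  par v = Some t -> par v' = Some t -> sim v v' -> v = v'.

Lemma sim_simulation P : simulation (@sim P).
Proof.
move=> u w [R simR Ruw]; have [uw chld] := simR _ _ Ruw; split=> // u' /chld[w' pw' R'].
by exists w' => //; exists R.
Qed.

Lemma sim_refl P (u : P) : sim u u.
Proof. by exists eq => // {}u _ <-; split=> // u' pu'; exists u'. Qed.

Lemma sim_trans P (u v w : P) : sim u v -> sim v w -> sim u w.
Proof.
move=> uv vw; exists (fun x z => exists2 y, sim x y & sim y z); last by exists v.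
move=> x z [y /sim_simulation[-> xy] /sim_simulation[-> yz]]; split=> // x'.
move=> /xy[y' /yz[z' pz' yz'] xy']; exists z' => //; by exists y'.
Qed.

Definition below P (v u : P) := connect [rel x y | par x == Some y] u v.

Lemma below_refl P (v : P) : below v v. Proof. exact: connect0. Qed.

Lemma below_par P (v u t : P) : par u = Some t -> below v t -> below v u.
Proof. by move=> ut; apply: connect_trans; apply: connect1; rewrite /= ut. Qed.

Lemma belowE P (v u : P) : below v u -> u = v \/ exists2 t, par u = Some t & below v t.
Proof.
case/connectP => -[|t p] /= => [_ ->|/andP[/eqP ut tp] vp]; first by left.
by right; exists t => //; apply/connectP; exists p.
Qed.

Hypothesis HQ : rooted_tree_quiver Q.

Lemma height_par P (u t : P) :
  forest_wf P -> par u = Some t -> (height (lab t) < height (lab u))%N.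
Proof. by move=> wP /wP[a <- <-]; exact: height_arrow. Qed.

Lemma height_below P (v u : P) : forest_wf P -> below v u ->
  u = v \/ (height (lab v) < height (lab u))%N.
Proof.
move=> wP /connectP[p]; elim: p u => [|t p IHp] u /=; first by left.
move=> /andP[/eqP ut tp] /(IHp _ tp)[<-|lt_vt]; right; first exact: height_par.
exact: ltn_trans lt_vt (height_par wP ut).
Qed.

(** The map is built from [v] downwards: once the parent of [u] is sent to a vertex simulating it,
    some child of that vertex simulates [u]. Values of [h] outside the tree below [v] are
    arbitrary. *)
Lemma sim_fun P (v v' : P) : forest_wf P -> sim v v' ->
  exists2 h : P -> P, h v = v' & forall u, below v u ->
    lab (h u) = lab u /\ (u <> v -> par (h u) = omap h (par u)).
Proof.
move=> wP vv'.
have [h hv hE] : exists2 h : P -> P, h v = v' & forall u, below v u ->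
    (height (lab u) <= #|Q|)%N ->
    sim u (h u) /\ (u <> v -> par (h u) = omap h (par u)).
  elim: #|Q| => [|n [h hv hE]].
    exists (fun=> v') => // u _; rewrite leqn0 => /eqP/card0_eq/(_ (lab u)).
    by rewrite !inE => /negP[]; exact: connect0.
  have /choice[g gE] : forall u, exists w, forall q, below v u -> u <> v ->
      (height (lab u) <= n.+1)%N -> par u = Some q -> par w = Some (h q) /\ sim u w.
    move=> u; case Eu: (par u) => [q|]; last by exists u.
    case: (pselect (below v u /\ u <> v /\ (height (lab u) <= n.+1)%N)); last first.
      by move=> no; exists u => q' vu uv un; case: no.
    move=> [vu [uv un]]; case/belowE: (vu) => [//|[q']]; rewrite Eu => -[<-] vq.
    have hq : (height (lab q) <= n)%N by rewrite -ltnS (leq_trans (height_par wP Eu)).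
    have [/sim_simulation[_ /(_ _ Eu)[w pw uw]] _] := hE _ vq hq.
    by exists w => _ _ _ _ [<-].
  (* The earlier map is kept up to height [n]; the next layer uses the chosen children, except that
     [v] itself goes to [v']. *)
  exists (fun u => if (height (lab u) <= n)%N then h u else if u == v then v' else g u).
    by rewrite eqxx hv if_same.
  move=> u vu un; case: (leqP (height (lab u)) n) => [le_un|lt_nu].
    have [su hu] := hE _ vu le_un; split=> // /hu ->.
    case Eu: (par u) => [q|//] /=.
    by rewrite (leq_trans (ltnW (height_par wP Eu)) le_un).
  case: eqP => [->|uv]; first by [].
  case/belowE: (vu) => [//|[q uq vq]]; have [pg sg] := gE u q vu uv un uq.
  split=> // _; rewrite pg uq /= -ltnS.
  by rewrite (leq_trans (height_par wP uq) un).
exists h => // u vu; have [/sim_simulation[ulab _] hu] := hE u vu (height_le _).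
by split.
Qed.

Definition cut P (v : P) : forest Q :=
  @Forest Q P lab (fun u => if u == v then None else par u).

Lemma cut_wf P (v : P) : forest_wf P -> forest_wf (cut v).
Proof. by move=> wP u t /=; case: eqP => // _; exact: wP. Qed.

Variable k : fieldType.

(* With [h] the map of the tree below [v] to the tree below its sibling [v'],
   the base change is [e_u |-> e_u + e_(h u)] for [u] below [v]. *)
Lemma frep_cut P (v v' t : P) : forest_wf P -> par v = Some t -> par v' = Some t ->
  sim v v' -> v <> v' -> rep_iso (frep k P) (frep k (cut v)).
Proof.
move=> wP pv pv' sv vv'; have [h hv hE] := sim_fun wP sv.
pose D u := below v u.
have Dt : ~~ D t.
  apply/negP => /(height_below wP)[tv|]; have := height_par wP pv; rewrite ?tv ?ltnn //.
  by move=> lt1 lt2; have := ltn_trans lt1 lt2; rewrite ltnn.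
have Dv' : ~~ D v'.
  by apply/negP => /belowE[/esym//|[q]]; rewrite pv' => -[<-]; apply/negP.
have parD u q : par u = Some q -> u <> v -> D u = D q.
  move=> uq uv; apply/idP/idP => [|/(below_par uq)//].
  by case/belowE => [//|[q']]; rewrite uq => -[<-].
(* Were [h u] below [v] with its parent outside, then [h u] would be [v] and the parent [t]; but
   that parent has the label of a vertex below [v], whose height exceeds that of [t]. Since [h]
   leaves the tree below [v], changing the sign inverts the base change. *)
have hD u : D u -> ~~ D (h u).
  have [n] := ubnP (height (lab u)); elim: n u => // n IHn u; rewrite ltnS => un Du.
  case: (eqVneq u v) => [->|/eqP uv]; first by rewrite hv.
  have [ulab /(_ uv) phu] := hE u Du; case/belowE: (Du) => // -[q uq Dq].
  rewrite uq in phu; have Dhq : ~~ D (h q).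
    by apply: IHn => //; exact: leq_trans (height_par wP uq) un.
  rewrite (parD _ _ phu) // => huv; move: phu; rewrite huv pv => -[tq].
  have [qlab _] := hE q Dq; have := height_par wP pv; rewrite tq qlab.
  case/(height_below wP): Dq => [->|]; rewrite ?ltnn //.
  by move=> lt1 lt2; have := ltn_trans lt1 lt2; rewrite ltnn.
have wC : forest_wf (cut v) by exact: cut_wf.
(* Here [i] only retypes vertices between [P] and [cut v], which share them; [c] is 1 for the
   isomorphism and -1 for its inverse. *)
pose F (c : k) (P' : forest Q) (i : P -> P') y u : frep k P' y :=
  bvec k y (i u) + (if D u then c *: bvec k y (i (h u)) else 0).
have [f fE] : exists f : rep_hom (frep k P) (frep k (cut v)),
    forall s y, lab s = y -> f y (bvec k y s) = F 1 (cut v) id y s.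
  apply: (frep_lift HQ wP) => a s sa; rewrite /F linearD /= frep_map_bvec //=.
  case: (eqVneq s v) => [sv'|sv'].
    rewrite sv' [D v]below_refl pv hv /= scale1r add0r (negPf Dt) addr0.
    rewrite frep_map_bvec /=; last by rewrite -sa sv'; have [] := sim_simulation sv.
    by rewrite [v' == v]eq_sym; case: eqP => // _; rewrite pv'.
  have /eqP sv'' := sv'; case Ds: (D s); last first.
    rewrite linear0 addr0; case Es: (par s) => [q|//] /=.
    by rewrite -(parD _ _ Es) // Ds addr0.
  have [slab /(_ sv'') hs] := hE s Ds.
  rewrite scale1r frep_map_bvec /=; last by rewrite slab.
  have /negPf-> : h s != v by apply: contraNneq (hD _ Ds) => ->; exact: below_refl.
  case/belowE: (Ds) => [//|[q sq Dq]]; rewrite hs sq /= [D q]Dq scale1r //.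
have [g gE] : exists g : rep_hom (frep k (cut v)) (frep k P),
    forall (s : cut v) y, lab s = y -> g y (bvec k y s) = F (- 1) P id y s.
  apply: (frep_lift HQ wC) => a s sa; rewrite /F linearD /= frep_map_bvec //=.
  case: (eqVneq s v) => [sv'|sv'].
    rewrite sv' [D v]below_refl pv hv /= scaleN1r linearN /=.
    rewrite frep_map_bvec; last by rewrite -sa sv'; have [] := sim_simulation sv.
    by rewrite pv' /= subrr.
  have /eqP sv'' := sv'; case Ds: (D s); last first.
    rewrite linear0 addr0; case Es: (@par Q P s) => [q|//] /=.
    by rewrite -(parD _ _ Es) // Ds addr0.
  have [slab /(_ sv'') hs] := hE s Ds.
  rewrite scaleN1r linearN /= frep_map_bvec /=; last by rewrite slab.
  by case/belowE: (Ds) => [//|[q sq Dq]]; rewrite hs sq /= [D q]Dq scaleN1r.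
exists f, g; split=> y v0.
  rewrite -[LHS]comp_lfunE -[RHS]id_lfunE; move: v0; apply: frep_ext => s sy.
  rewrite comp_lfunE id_lfunE fE // /F linearD /= gE //.
  rewrite /F; case Ds: (D s); last by rewrite linear0 !addr0.
  rewrite !scale1r gE /F; last by rewrite /= (hE s Ds).1.
  by rewrite (negPf (hD s Ds)) addr0 scaleN1r subrK.
rewrite -[LHS]comp_lfunE -[RHS]id_lfunE; move: v0; apply: frep_ext => s sy.
rewrite comp_lfunE id_lfunE gE // /F linearD /= fE //.
rewrite /F; case Ds: (D s); last by rewrite linear0 !addr0.
rewrite scaleN1r linearN /= fE /F; last by rewrite /= (hE s Ds).1.
by rewrite (negPf (hD s Ds)) addr0 scale1r addrK.
Qed.

(** Each cut makes one more vertex a root, so the number of vertices with a parent decreases. *)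
Lemma forest_reduce P : forest_wf P ->
  exists P', [/\ forest_wf P', antichain P' & rep_iso (frep k P) (frep k P')].
Proof.
have [n] := ubnP #|[pred u : P | par u != None]|; elim: n P => // n IHn P.
rewrite ltnS => Pn wP; case: (pselect (antichain P)) => [aP|].
  by exists P; split=> //; exact: rep_iso_refl.
move=> /existsNP[v /existsNP[v' /existsNP[t]]].
move=> /not_implyP[pv /not_implyP[pv' /not_implyP[sv vv']]].
have [||P' [wP' aP' isoP']] := IHn (cut v).
- apply: leq_trans Pn; apply/proper_card/properP; split.
    by apply/fintype.subsetP => u; rewrite !inE /=; case: (u == v).
  by exists v; rewrite !inE /= ?pv // eqxx.
- exact: cut_wf.
by exists P'; split=> //; apply: rep_iso_trans isoP'; exact: (frep_cut wP pv pv').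
Qed.

End Simulation.

(** * Endomorphisms of linearized trees *)

Section TreeModules.
Variables (k : fieldType) (Q : quiver).
Hypothesis HQ : rooted_tree_quiver Q.
Implicit Types P : forest Q.

Definition forest_root P (r : P) := par r = None /\ forall s : P, par s = None -> s = r.

Lemma below_root P (s : P) : forest_wf P -> exists2 r, par r = None & below r s.
Proof.
move=> wP; have [n] := ubnP (height (lab s)); elim: n s => // n IHn s.
rewrite ltnS => sn; case Es: (par s) => [t|]; last by exists s; rewrite ?below_refl.
have [r r0 rt] := IHn t (leq_trans (height_par HQ wP Es) sn).
by exists r => //; exact: below_par Es rt.
Qed.

Lemma below_root_unique P (r r' s : P) : forest_wf P -> par r = None ->
  par r' = None -> below r s -> below r' s -> r = r'.
Proof.
move=> wP r0 r'0; have [n] := ubnP (height (lab s)); elim: n s => // n IHn s.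
rewrite ltnS => sn /belowE[->|[t st rt]] /belowE[sr'|[t' st' rt']].
- by [].
- by rewrite r0 in st'.
- by rewrite sr' r'0 in st.
- move: st'; rewrite st => -[tt']; rewrite -tt' in rt'.
  exact: IHn (leq_trans (height_par HQ wP st) sn) rt rt'.
Qed.

Section Idempotent.
Variables (P : forest Q) (r : P).
Hypotheses (wP : forest_wf P) (aP : antichain P) (rP : forest_root r).

(** Every other vertex lies strictly below [r], so its label has larger height. Hence the space over
    [lab r] is a line. *)
Lemma root_fiber (s : P) : lab s = lab r -> s = r.
Proof.
have [r' r'0 r's] := below_root s wP; rewrite (rP.2 _ r'0) in r's.
by case: (height_below HQ wP r's) => // + sr; rewrite sr ltnn.
Qed.

(** If [w] occurs in [f u] and [u'] is a child of [u], the coefficient of [w] in [f u] is the sum of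
    those of the children of [w] in [f u']; being nonzero, it has a nonzero term. *)
Lemma endo_simulation (f : rep_hom (frep k P) (frep k P)) :
  simulation (fun u w : P => exists y,
    [/\ lab u = y, lab w = y & cf w (f y (bvec k y u) : frep_sp k P y) != 0]).
Proof.
move=> u w [y [uy wy fuw]]; split; first by rewrite uy wy.
move=> u' u'u; have [a sa ta] := wP u'u; rewrite uy in ta.
move: uy wy fuw; rewrite -{}ta => uy wy fuw.
have : cf w (f (tgt a) (rep_map (frep k P) a (bvec k (src a) u'))) != 0.
  by rewrite frep_map_bvec ?u'u.
rewrite rep_hom_nat cf_frep_map //.
case: (pickP [pred w' : P | (lab w' == src a) && (par w' == Some w) &&
    (cf w' (f (src a) (bvec k (src a) u')) != 0)])
    => [w' /andP[/andP[/eqP w'a /eqP w'w] fw' _]|no].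
  by exists w' => //; exists (src a).
rewrite big1 ?eqxx // => w' w'w; apply/eqP; have := no w'.
by rewrite /= w'w /= => /negbFE.
Qed.

Lemma idempotent_root0 (f : rep_hom (frep k P) (frep k P)) :
    (forall x v, f x (f x v) = f x v) ->
    f (lab r) (bvec k (lab r) r) = 0 -> forall x v, f x v = 0.
Proof.
move=> ff fr; suff f0 (u : P) y : lab u = y -> f y (bvec k y u) = 0.
  move=> x v; rewrite -[RHS](@zero_lfunE _ (frep k P x) (frep k P x) v); move: v.
  by apply: frep_ext => s sx; rewrite f0 // zero_lfunE.
have [n] := ubnP (height y); elim: n u y => // n IHn u y; rewrite ltnS => yn uy.
(* By induction [f] kills the parent of [u'], so a sibling [w'] of [w] also occurs in the image of
   [u']. Then [sim w u'] would give [sim w w'], against the antichain condition. *)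
have strict (u' w : P) : lab u' = y -> lab w = y ->
    cf w (f y (bvec k y u') : frep_sp k P y) != 0 -> sim u' w /\ ~ sim w u'.
  move=> u'y wy fuw; have suw (w' : P) : lab w' = y ->
      cf w' (f y (bvec k y u') : frep_sp k P y) != 0 -> sim u' w'.
    by move=> w'y fuw'; apply: ex_intro2; [exact: (endo_simulation (f := f))|exists y].
  split; first exact: suw.
  case Eu: (par u') => [t|]; last first.
    by move: fuw; rewrite -u'y (rP.2 _ Eu) fr cf0 eqxx.
  have [a sa ta] := wP Eu; rewrite u'y in sa.
  move: yn u'y wy fuw suw; rewrite -{}sa => yn u'y wy fuw suw.
  have ft : rep_map (frep k P) a (f (src a) (bvec k (src a) u')) = 0.
    rewrite -rep_hom_nat frep_map_bvec // Eu /= IHn //.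
    exact: leq_trans (height_arrow HQ a) yn.
  case Ew: (par w) => [q|]; last first.
    have wr := rP.2 _ Ew; have u'r : u' = r by apply: root_fiber; rewrite u'y -wr wy.
    by rewrite u'r rP.1 in Eu.
  have qa := lab_par HQ wP Ew wy.
  have := cf_frep_map HQ (f (src a) (bvec k (src a) u') : frep k P (src a)) wP qa.
  rewrite ft cf0 (bigD1 w) ?wy ?Ew ?eqxx //= => /eqP.
  rewrite eq_sym; case: (pickP [pred w' : P | (lab w' == src a) && (par w' == Some q) &&
    (w' != w) && (cf w' (f (src a) (bvec k (src a) u')) != 0)])
    => [w' /andP[/andP[/andP[/eqP w'a /eqP w'q] w'w] fw'] _|no].
    move=> swu; move/eqP: w'w; apply; apply/esym/(aP Ew w'q).
    exact: sim_trans swu (suw _ w'a fw').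
  rewrite big1 ?addr0 ?(negPf fuw) // => w' w'w; apply/eqP; have := no w'.
  by rewrite /= w'w /= => /negbFE.
(* The inner induction runs on the number of vertices simulated by [w]. If [w] occurs in [f u], it
   occurs in [f (f u)], through some [v] occurring in [f u]; by [strict] this [v] simulates fewer
   vertices, so its coefficient is already zero. *)
apply: cf_ext => w wy; rewrite cf0; pose N (w : P) := #|[pred v : P | `[< sim v w >]]|.
have [m] := ubnP (N w); elim: m w wy => // m IHm w wy; rewrite ltnS => wm.
apply/eqP/negPn/negP => fuw.
have : cf w (f y (f y (bvec k y u)) : frep_sp k P y) != 0 by rewrite ff.
rewrite cf_apply.
case: (pickP [pred v : P | (lab v == y) && (cf v (f y (bvec k y u) : frep_sp k P y) != 0) &&
   (cf w (f y (bvec k y v) : frep_sp k P y) != 0)]) => [v /andP[/andP[/eqP vy fuv] fvw]|no].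
  have [svw swv] := strict v w vy wy fvw; case/eqP: fuv; apply: IHm => //.
  apply: leq_trans wm; apply/proper_card/properP; split.
    apply/fintype.subsetP => x; rewrite !unfold_in /= => /asboolP xv; apply/asboolP.
    exact: sim_trans xv svw.
  by exists w; rewrite unfold_in /=; [apply/asboolP; exact: sim_refl|apply/asboolP].
rewrite big1 ?eqxx // => v /eqP vy; apply/eqP; rewrite mulf_eq0.
by have := no v; rewrite /= vy eqxx /= -negb_or => /negbFE.
Qed.

(** On the line over [lab r], [f] is a scalar with [c * c = c], so [idempotent_root0] applies to [f]
    or to the identity minus [f]. *)
Lemma tree_idempotent (f : rep_hom (frep k P) (frep k P)) :
    (forall x v, f x (f x v) = f x v) ->
  (forall x v, f x v = 0) \/ (forall x v, f x v = v).
Proof.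
move=> ff; pose y := lab r; pose e := bvec k y r; pose c := cf r (f y e : frep_sp k P y).
have fr : f y e = c *: e.
  rewrite [LHS]cf_sum (bigD1 r) //= big1 ?addr0 // => s /andP[/eqP sr].
  by rewrite (root_fiber sr) eqxx.
have cc : c * c = c.
  have /(congr1 (cf r)) := ff y e; rewrite fr linearZ /= fr scalerA !cfZ.
  by rewrite cf_bvec // eqxx !mulr1.
have /eqP : c * (c - 1) = 0 by rewrite mulrBr mulr1 cc subrr.
rewrite mulf_eq0 subr_eq0 => /orP[/eqP c0|/eqP c1].
  by left; apply: idempotent_root0; rewrite // -/e -/y fr c0 scale0r.
right=> x v; pose g := rh_sub (rh_id (frep k P)) f.
have gE z w : g z w = w - f z w by rewrite rh_subE rh_idE.
suff : g x v = 0 by rewrite gE => /eqP; rewrite subr_eq0 eq_sym => /eqP.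
apply: idempotent_root0 => [z w|]; last by rewrite gE -/e -/y fr c1 scale1r subrr.
by rewrite !gE linearB /= ff subrr subr0.
Qed.

End Idempotent.

(** * Splitting a forest into trees; the Krull-Schmidt argument *)

Section SubForest.
Variables (P : forest Q) (D : pred P).
Hypothesis closedD : forall s t : P, par s = Some t -> D s = D t.

Definition sub_forest : forest Q :=
  @Forest Q {s : P | D s} (fun s => lab (val s)) (fun s => obind insub (par (val s))).

Lemma sub_par (s : sub_forest) : par (val s) = omap val (par s).
Proof.
rewrite /=; case Es: (par (val s)) => [t|//] /=.
by rewrite insubT // -(closedD Es) (valP s).
Qed.

Lemma sub_parE (s t : sub_forest) : par s = Some t <-> par (val s) = Some (val t).
Proof.
rewrite sub_par; case: (par s) => [u|//]; split=> [[->]//|[/val_inj->]] //.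
Qed.

Lemma sub_wf : forest_wf P -> forest_wf sub_forest.
Proof. by move=> wP s t /sub_parE/wP. Qed.

Lemma sub_antichain : antichain P -> antichain sub_forest.
Proof.
move=> aP v v' t /sub_parE vt /sub_parE vt' [R simR Rvv']; apply: val_inj.
apply: (aP _ _ _ vt vt'); exists (fun x z => exists s s', [/\ val s = x, val s' = z & R s s']).
  move=> x z [s [s' [<- <- /simR[ss' Rss']]]]; split=> // u us.
  have Du : D u by rewrite (closedD us) (valP s).
  have [//|w' /sub_parE ws' Rw'] := Rss' (exist _ u Du).
    exact/sub_parE.
  by exists (val w') => //; exists (exist _ u Du), w'.
by exists v, v'.
Qed.

(** [D] is a union of whole trees, so both extension by zero and restriction are natural. *)
Lemma sub_frep : forest_wf P ->
  exists (i : rep_hom (frep k sub_forest) (frep k P))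
         (p : rep_hom (frep k P) (frep k sub_forest)),
    (forall x v, p x (i x v) = v) /\ 
    (forall s y, lab s = y -> i y (p y (bvec k y s)) = if D s then bvec k y s else 0).
Proof.
move=> wP; have wS := sub_wf wP.
have [|i iE] := @frep_lift k Q HQ sub_forest (frep k P) (fun y s => bvec k y (val s)) wS.
  by move=> a s sa; rewrite frep_map_bvec // sub_par; case: (par s).
have [|p pE] := @frep_lift k Q HQ P (frep k sub_forest)
    (fun y s => oapp (bvec k y) 0 (insub s : option sub_forest)) wP.
  move=> a s sa; case: insubP => [t Ds ts|nDs] /=; last first.
    rewrite linear0; case Es: (par s) => [t|//] /=.
    by rewrite insubN // -(closedD Es).
  rewrite frep_map_bvec; last by rewrite /= ts.
  by rewrite /= ts; case: (par s).
exists i, p; split=> [x v|s y sy].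
  rewrite -[LHS]comp_lfunE -[RHS]id_lfunE; move: v; apply: frep_ext => s sx.
  by rewrite comp_lfunE id_lfunE iE // pE // valK.
rewrite pE //; case: insubP => [t -> ts|/negPf->] /=; last by rewrite linear0.
by rewrite iE /= ?ts.
Qed.

End SubForest.

Lemma below_closed P (r : P) : par r = None ->
  forall s t : P, par s = Some t -> below r s = below r t.
Proof.
move=> r0 s t st; apply/idP/idP => [/belowE[sr|[t']]|]; last exact: below_par.
  by move: st; rewrite sr r0.
by rewrite st => -[->].
Qed.

(** The identity of [V] is the sum over the trees of [P] of the endomorphisms factoring through
    each. Locality makes one of them invertible, so [V] is a retract of that tree, and a nonzero
    retract of a tree is all of it. *)
Lemma local_retract_tree (V : rep k Q) P : local_rep V -> ~ rep_zero V ->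
    retract V (frep k P) -> forest_wf P -> antichain P ->
  exists P', [/\ forest_wf P', antichain P', exists r : P', forest_root r
    & rep_iso V (frep k P')].
Proof.
move=> Vloc V0 [i [p ip]] wP aP; pose I := {r : P | par r == None}.
have cl (r : I) := below_closed (eqP (valP r)).
pose cii r := cid (sub_frep (cl r) wP); pose ii r := sval (cii r).
pose cpp r := cid (svalP (cii r)); pose pp r := sval (cpp r).
have ippE r s y : lab s = y ->
    ii r y (pp r y (bvec k y s)) = if below (val r) s then bvec k y s else 0.
  exact: (svalP (cpp r)).2.
pose f r := rh_comp (rh_comp p (ii r)) (rh_comp (pp r) i).
have fE x v : rh_sum (index_enum I) f x v = v.
  rewrite rh_sumE -{2}(ip x v).
  under eq_bigr do rewrite !rh_compE.
  rewrite -linear_sum; congr (p x _); move: (i x v) => {}v.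
  rewrite -[RHS]id_lfunE; under eq_bigr do rewrite -comp_lfunE.
  rewrite -sum_lfunE; move: v; apply: frep_ext => s sx; rewrite sum_lfunE id_lfunE.
  have [r r0 rs] := below_root s wP; have r0' : par r == None by apply/eqP.
  rewrite (bigD1 (exist _ r r0' : I)) // comp_lfunE ippE // [below _ _]rs.
  rewrite big1 /= ?addr0 // => r' rr'.
  rewrite comp_lfunE ippE //; case: ifP => // r's.
  case/eqP: rr'; apply: val_inj => /=; apply: below_root_unique r's rs => //.
  exact/eqP/(valP r').
have [|r /rep_inj_inv[g gK]] := local_rep_sum Vloc V0 (f := f) (r := index_enum I).
  by move=> x v w; rewrite !fE.
pose M := sub_forest (below (val r)).
have wM : forest_wf M by exact: sub_wf (cl r) wP.
have aM : antichain M by exact: sub_antichain (cl r) aP.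
have rM : exists r : M, forest_root r.
  exists (exist _ (val r) (below_refl _)); split=> [|s s0]; first by rewrite /= (eqP (valP r)).
  apply: val_inj => /=; have := sub_par (cl r) s; rewrite s0 /= => ps.
  by case/belowE: (valP s) => // -[t]; rewrite ps.
exists M; split=> //; have [rr rrM] := rM.
pose A := rh_comp (pp r) i; pose B := rh_comp p (ii r).
have BA x v : B x (A x v) = f r x v by rewrite /f !rh_compE.
have gBA x v : g x (B x (A x v)) = v by rewrite BA (gK x).1.
have eE x v : rh_comp A (rh_comp g B) x v = A x (g x (B x v)).
  by rewrite [LHS]rh_compE [rh_comp g B x v]rh_compE.
(* The idempotent of the tree that projects onto the copy of [V]; it is not 0 because [V] is not. *)
case: (tree_idempotent wM aM rrM (f := rh_comp A (rh_comp g B))) => [x v|e0|e1].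
- by rewrite !eE gBA.
- case: V0 => x v; have := e0 x (A x v).
  by rewrite eE gBA -{2}(gBA x v) => ->; rewrite !linear0.
exists A, (rh_comp g B); split=> x v; first by rewrite [LHS]rh_compE gBA.
by rewrite [rh_comp g B x v]rh_compE -eE e1.
Qed.

End TreeModules.

(** * Forests and [H0] *)

Section H0Forest.
Local Open Scope classical_set_scope.
Variables (R : realType) (k : fieldType) (Q : quiver).
Hypothesis HQ : rooted_tree_quiver Q.
Implicit Types (P : forest Q) (X : top_diagram R Q).

Definition forest_total P := forall s : P, par s = None -> is_root (lab s).

Section H0Rep.
Variables (X : top_diagram R Q) (P : forest Q) (cl : forall y, X y -> P)
  (pt : forall y (s : P), lab s = y -> X y).
Hypotheses (wP : forest_wf P) (lab_cl : forall y x, lab (@cl y x) = y).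
Hypothesis clK : forall y s (sy : lab s = y), cl (pt sy) = s.
Hypothesis cl_joined : forall y x x', cl x = cl x' <-> @joined R (X y) x x'.
Hypothesis par_cl : forall a (x : X (src a)),
  par (cl x) = Some (cl (td_map X (qarrow a) x)).

(** The vertices of [P] are the path components, [cl] sends a point to its component and [pt] picks
    a point in each. The classes of the chosen points then form a basis of [H0]. *)
Lemma H0_rep_forest : rep_iso (H0_rep k X) (frep k P).
Proof.
pose b y (s : P) : H0_fin k (X y) :=
  if pselect (lab s = y) is left sy then H0_class R k (pt sy) else 0.
have bE y x : b y (@cl y x) = H0_class R k x.
  rewrite /b; case: pselect => [sy|[]]; last exact: lab_cl.
  by apply: H0_class_joined; apply/cl_joined; rewrite clK.
pose c y (x : X y) : frep_sp k P y := bvec k y (cl x).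
have cJ y x x' : @joined R (X y) x x' -> c y x = c y x' by rewrite /c => /cl_joined->.
pose co y : {linear H0_fin k (X y) -> frep_sp k P y} :=
  HB.pack (H0_lift (c y) : H0_fin k (X y) -> _)
  (GRing.isLinear.Build k (H0_fin k (X y)) (frep_sp k P y) _ _ (H0_lift_linear (cJ y))).
have coE y x : co y (H0_class R k x) = c y x := H0_lift_class (cJ y) x.
apply: (@frep_iso k Q HQ P (H0_rep k X) b co) => //.
- move=> a s sa; rewrite -(clK sa) bE /= H0_fin_mapE H0_map_class par_cl /=.
  by rewrite bE.
- by move=> y s sy; rewrite -(clK sy) bE coE /c clK.
(* A left inverse only has to be checked on classes of points; retyping the maps over [H0] makes
   [H0_ext] applicable. *)
move=> y; apply: (can_inj (g := lift_vec (b y))) => v.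
pose g : {linear H0 R k (X y) -> H0 R k (X y)} :=
  (lift_vec (b y) : {linear frep_sp k P y -> H0 R k (X y)}) \o
  (co y : {linear H0 R k (X y) -> _}).
rewrite -[LHS]/(g v) -[RHS]/(idfun v); move: v; apply: H0_ext => x.
change (lift_vec (b y) (co y (H0_class R k x)) = H0_class R k x).
by rewrite coE lift_vec_bvec ?lab_cl // bE.
Qed.

End H0Rep.

(** Path components are sets of points; numbering them provides the finite type of vertices of a
    forest. *)
Lemma components_ord (X : fintop R) : exists n (ix : X -> 'I_n) (pt : 'I_n -> X),
  cancel pt ix /\ forall x x', ix x = ix x' <-> joined R x x'.
Proof.
have /finite_seqP/cid[s0 s0E] := fintop_components X.
pose s := undup s0; have sP x : (index (path_component R x) s < size s)%N.
  rewrite index_mem mem_undup.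
  have : range (@path_component R X) (path_component R x) by exists x.
  by rewrite s0E.
pose ix x : 'I_(size s) := Ordinal (sP x).
have /choice[pt ptK] : forall i : 'I_(size s), exists x, ix x = i.
  move=> i; have : nth set0 s i \in s0 by rewrite -mem_undup mem_nth.
  have -> : nth set0 s i \in s0 = [set` s0] (nth set0 s i) :> Prop by [].
  rewrite -s0E => -[x _ xE]; exists x; apply/val_inj.
  by rewrite /= xE index_uniq ?undup_uniq.
exists (size s), ix, pt; split=> // x x'; rewrite -path_componentP.
split=> [/(congr1 val) /= /(congr1 (nth set0 s))|xx']; last by apply/val_inj; rewrite /= xx'.
by rewrite !nth_index -?index_mem.
Qed.

Lemma H0_rep_is_forest X : exists P,
  [/\ forest_wf P, forest_total P & rep_iso (H0_rep k X) (frep k P)].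
Proof.
pose n y := sval (cid (components_ord (X y))).
pose cix y := cid (svalP (cid (components_ord (X y)))).
pose cpt y := cid (svalP (cix y)).
pose ix y : X y -> 'I_(n y) := sval (cix y).
pose pt y : 'I_(n y) -> X y := sval (cpt y).
have ptK y : cancel (pt y) (ix y) := (svalP (cpt y)).1.
have ixJ y x x' : ix y x = ix y x' <-> joined R x x' := (svalP (cpt y)).2 x x'.
pose T : finType := {y : Q & 'I_(n y)}.
pose cl y (x : X y) : T := Tagged (fun y => 'I_(n y)) (ix y x).
(* The parent of a component is the one containing its image along the outgoing arrow. This is a
   partial function because the arrow is unique and continuous maps preserve [joined]. *)
pose rel (s t : T) := exists a (x : X (src a)),
  s = cl _ x /\ t = cl _ (td_map X (qarrow a) x).
have cl_joined y x x' : cl y x = cl y x' <-> joined R x x'.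
  rewrite -ixJ; split=> [/eqP|]; last by rewrite /cl => ->.
  by rewrite eq_Tagged /= => /eqP.
have rel_fun s t t' : rel s t -> rel s t' -> t = t'.
  move=> [a [x [-> ->]]] [a' [x' [clE ->]]].
  have aa' : a = a' := rooted_tree_arrow_inj HQ (congr1 tag clE).
  by move: x' clE; rewrite -{a'}aa' => x' /cl_joined xx'; apply/cl_joined/joined_map.
pose prt s : option T :=
  if pselect (exists t, rel s t) is left e then Some (sval (cid e)) else None.
have prtE s t : rel s t -> prt s = Some t.
  move=> st; rewrite /prt; case: pselect => [e|[]]; last by exists t.
  by congr Some; apply: rel_fun st; exact: svalP (cid e).
have prtS s t : prt s = Some t -> rel s t.
  by rewrite /prt; case: pselect => // e [<-]; exact: svalP (cid e).
pose P := @Forest Q T tag prt.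
have wP : forest_wf P by move=> s t /prtS[a [x [-> ->]]]; exists a.
have ptT y (s : T) : tag s = y -> {x : X y | cl y x = s}.
  by case: s => z i /= <-; exists (pt z i); rewrite /cl ptK.
exists P; split.
- exact: wP.
- move=> [y i]; rewrite /= => sN; apply/is_rootP => a ay.
  move: i sN; rewrite -{y}ay => i sN.
  have st : rel (existT _ (src a) i) (cl (tgt a) (td_map X (qarrow a) (pt _ i))).
    by exists a, (pt _ i); rewrite /cl ptK.
  by rewrite (prtE _ _ st) in sN.
apply: (@H0_rep_forest X P cl (fun y s sy => sval (ptT y s sy))) => //.
- by move=> y s sy; exact: svalP (ptT y s sy).
- by move=> a x; apply: prtE; exists a, x.
Qed.

(** Extended to [R] by [clamp], a path has clopen level sets, and [R] is connected. *)
Lemma joined_discrete (T : discreteTopologicalType) (x y : T) : joined R x y -> x = y.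
Proof.
move=> [p [<- <-]]; pose g : R -> T := p \o @clamp R.
have gc : continuous g by exact: simplex_clamp_continuous.
have cR : connected [set: R] by apply/connected_intervalP.
have gE : g @^-1` [set g 0] = setT.
  apply: cR.
  - by exists 0.
  - exists (g @^-1` [set g 0]); last by rewrite setTI.
    by apply: open_comp => [t _|]; [exact: gc|exact: discrete_open].
  - exists (g @^-1` [set g 0]); last by rewrite setTI.
    by apply: closed_comp => [t _|]; [exact: gc|exact: discrete_closed].
have : (g @^-1` [set g 0]) 1 by rewrite gE.
by rewrite /g /= (@clamp0 R 0) // (@clamp1 R 1).
Qed.

Lemma discrete_cont (S T : choiceType) (f : S -> T) :
  continuous (f : discrete_topology S -> discrete_topology T).
Proof.
move=> x; apply/discrete_cvg.
apply: (@filterS _ (nbhs (x : discrete_topology S)) _ [set x]).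
  by move=> z ->.
exact: discrete_set1.
Qed.

(** * Realization of total forests by discrete spaces *)

Section Realization.
Variable P : forest Q.
Hypotheses (wP : forest_wf P) (tP : forest_total P).

Definition disc_fib (y : Q) := discrete_topology (fib P y).

Fact disc_fib_fin y : finite_set (range (@path_component R (disc_fib y))).
Proof. by apply: finite_image; exact: (@finite_finset (fib P y)). Qed.

Definition disc_fintop y : fintop R := FinTop (disc_fib_fin y).

Fact step_subproof a (s : fib P (src a)) : {t : fib P (tgt a) | par (val s) = Some (val t)}.
Proof.
case Es: (par (val s)) => [t|].
  have ta : lab t == tgt a by apply/eqP/(lab_par HQ wP Es)/eqP/(valP s).
  by exists (exist _ t ta).
have := tP Es; rewrite (eqP (valP s)) => /is_rootP noa.
by case: (noa a).
Qed.

Fixpoint disc_map x y (p : qpath x y) : fib P x -> fib P y :=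
  match p in qpath x y return fib P x -> fib P y with
  | qnil _ => id
  | qcons a _ p => fun s => disc_map p (sval (step_subproof s))
  end.

Lemma disc_map_cat x y z (p : qpath x y) (q : qpath y z) :
  disc_map (qcat p q) =1 disc_map q \o disc_map p.
Proof. by elim: p q => //= a {}y p IHp q s; rewrite IHp. Qed.

(** The fibres of [P] are taken as discrete spaces. Totality is what turns [par] into a map of
    fibres along every arrow. *)
Lemma forest_is_H0_rep : rep_H0 k R (frep k P).
Proof.
pose td x y (p : qpath x y) : continuousType (disc_fintop x) (disc_fintop y) :=
  mkcts (@discrete_cont _ _ (disc_map p)).
pose X := @TopDiagram R Q disc_fintop td (fun x s => erefl) disc_map_cat.
exists X; apply/rep_iso_sym.
apply: (@H0_rep_forest X P (fun y s => val s)
  (fun y s sy => exist (fun s => lab s == y) s (introT eqP sy))) => //.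
- by move=> y x; exact: eqP (valP x).
- move=> y x x'; split=> [/val_inj->|/joined_discrete->//]; exact: joined_refl.
- by move=> a x; exact: svalP (step_subproof x).
Qed.

End Realization.
End H0Forest.

(** * The additive closure *)

Section Closure.
Variables (R : realType) (k : fieldType) (Q : quiver).
Hypothesis HQ : rooted_tree_quiver Q.
Implicit Types (P : forest Q) (V W : rep k Q).

Lemma summand_retract V W : direct_summand V W -> retract V W.
Proof.
move=> [W' [f [g [fg gf]]]].
pose VW := fun b : bool => if b then V else W'.
exists (rh_comp g (rh_in VW true)), (rh_comp (rh_pr VW true) f) => x v.
by rewrite !rh_compE gf (rh_pr_in (V := VW) (i := true)).
Qed.

Lemma rep_dsum_retract (I : finType) (V W : I -> rep k Q) :
  (forall i, retract (V i) (W i)) -> retract (rep_dsum V) (rep_dsum W).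
Proof.
move=> /(fun H i => cid (H i)) H; pose s i := sval (H i).
have /(fun H i => cid (H i)) H' := fun i => svalP (H i); pose r i := sval (H' i).
have rs i x : cancel (s i x) (r i x) := svalP (H' i) x.
have copair (U U' : I -> rep k Q) (f : forall i, rep_hom (U i) (U' i)) x w j :
    rh_pr U' j x (rh_copair (fun i => rh_comp (rh_in U' i) (f i)) x w) = f j x (rh_pr U j x w).
  rewrite rh_copairE linear_sum (bigD1 j) //= big1 ?addr0 => [|i ij].
    by rewrite comp_lfunE !dsum_prE dsum_inE dfwith_in.
  by rewrite comp_lfunE dsum_prE dsum_inE dfwith_out.
exists (rh_copair (fun i => rh_comp (rh_in W i) (s i))).
exists (rh_copair (fun i => rh_comp (rh_in V i) (r i))) => x v.
rewrite -[LHS]rh_in_pr -[RHS]rh_in_pr; apply: eq_bigr => j _.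
by rewrite !copair rs.
Qed.

Section Coproduct.
Variables (I : finType) (P : I -> forest Q).

Definition coproduct : forest Q := @Forest Q {i : I & P i}
  (fun s => lab (tagged s)) (fun s => omap (Tagged (fun i => P i)) (par (tagged s))).

Lemma coproduct_wf : (forall i, forest_wf (P i)) -> forest_wf coproduct.
Proof.
by move=> wP [i s] t /=; case Es: (par s) => [u|//] [<-]; exact: wP Es.
Qed.

Lemma coproduct_total : (forall i, forest_total (P i)) -> forest_total coproduct.
Proof. by move=> tP [i s] /=; case Es: (par s) => // _; exact: tP Es. Qed.

Lemma coproduct_retract : (forall i, forest_wf (P i)) ->
  retract (rep_dsum (fun i => frep k (P i))) (frep k coproduct).
Proof.
move=> wP; pose F := fun i => frep k (P i).
have /(fun H i => cid (H i)) j i : exists f : rep_hom (F i) (frep k coproduct),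
    forall s y, lab s = y -> f y (bvec k y s) = bvec k y (existT _ i s : coproduct).
  apply: (@frep_lift k Q HQ (P i) (frep k coproduct)
    (fun y s => bvec k y (existT _ i s : coproduct)) (wP i)).
  by move=> a s sa; rewrite frep_map_bvec //=; case: (par s).
have [|f fE] := @frep_lift k Q HQ coproduct (rep_dsum F)
    (fun y s => rh_in F (tag s) y (bvec k y (tagged s))) (coproduct_wf wP).
  move=> a [i s] sa; rewrite -(rep_hom_nat (rh_in F i)) frep_map_bvec //=.
  by case: (par s) => [t|] //=; rewrite linear0.
exists (rh_copair (fun i => sval (j i))), f => x w.
rewrite rh_copairE linear_sum -[RHS]rh_in_pr; apply: eq_bigr => i _.
rewrite rh_prE -[LHS]rh_compE; move: ((w : dsum _) i); apply: frep_ext => s sx.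
by rewrite rh_compE (svalP (j i)) // fE.
Qed.

End Coproduct.

(** Total forests are stable under coproducts, so one forest accommodates all terms of a direct sum.
    Conversely, [V] is a one-term sum of a direct summand of [frep P]. *)
Lemma closure_retractP V : additive_closure (rep_H0 k R) V <->
  exists P, [/\ forest_wf P, forest_total P & retract V (frep k P)].
Proof.
split=> [[n [W [WA VW]]]|[P [wP tP VP]]].
  have /choice[P PE] : forall i, exists P,
      [/\ forest_wf P, forest_total P & retract (W i) (frep k P)].
    move=> i; have [U [X UX] WU] := WA i.
    have [P [wP tP XP]] := H0_rep_is_forest k HQ X; exists P; split=> //.
    apply: retract_trans (summand_retract WU) (rep_iso_retract _).
    exact: rep_iso_trans UX XP.
  exists (coproduct P); split.
  - by apply: coproduct_wf => i; case: (PE i).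
  - by apply: coproduct_total => i; case: (PE i).
  apply: retract_trans (rep_iso_retract VW) _.
  apply: retract_trans (coproduct_retract _); last by move=> i; case: (PE i).
  by apply: rep_dsum_retract => i; case: (PE i).
exists 1%N, (fun=> V); split=> [_|].
  by exists (frep k P); [exact: forest_is_H0_rep|exact: retract_summand].
exists (rh_in (fun=> V) ord0), (rh_pr (fun=> V) ord0); split=> x v.
  exact: (rh_pr_in (V := fun=> V)).
by rewrite -[RHS](rh_in_pr (V := fun=> V)) big_ord1.
Qed.

Lemma closure_retract V W : retract V W ->
  additive_closure (rep_H0 k R) W -> additive_closure (rep_H0 k R) V.
Proof.
move=> VW /closure_retractP[P [wP tP WP]]; apply/closure_retractP.
by exists P; split=> //; exact: retract_trans WP.
Qed.

Section Completion.
Variable P : forest Q.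
Hypothesis wP : forest_wf P.

Definition next_vert (q : Q) : option Q := omap tgt [pick a : arr Q | src a == q].

Lemma next_arrow a : next_vert (src a) = Some (tgt a).
Proof.
rewrite /next_vert; case: pickP => [b /eqP/(rooted_tree_arrow_inj HQ)->|/(_ a)] //.
by rewrite eqxx.
Qed.

Lemma next_some q t : next_vert q = Some t -> exists2 a : arr Q, src a = q & tgt a = t.
Proof. by rewrite /next_vert; case: pickP => // a /eqP <- [<-]; exists a. Qed.

Lemma next_none q : next_vert q = None -> is_root q.
Proof.
rewrite /next_vert; case: pickP => // noa _; apply/is_rootP => a aq.
by have := noa a; rewrite aq eqxx.
Qed.

(* Each root of [P] is attached to a copy of [Q]; a base change identifies
   [frep P] with the kernel of the retraction onto this copy. *)
Definition completion : forest Q := @Forest Q (P + Q)%type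
  (fun s => match s with inl s => lab s | inr q => q end)
  (fun s => match s with
   | inl s => if par s is Some t then Some (inl t) else omap inr (next_vert (lab s))
   | inr q => omap inr (next_vert q)
   end).

Lemma completion_wf : forest_wf completion.
Proof.
have wn q t : omap (@inr P Q) (next_vert q) = Some t ->
    exists2 a : arr Q, src a = q & tgt a = lab (t : completion).
  by case Eq: (next_vert q) => [u|//] [<-]; exact: next_some Eq.
move=> [s|q] t /=; last exact: wn.
by case Es: (par s) => [u|]; [case=> <-; exact: wP Es|exact: wn].
Qed.

Lemma completion_total : forest_total completion.
Proof.
move=> [s|q] /=; last by case Eq: (next_vert q) => // _; exact: next_none Eq.
by case: (par s) => //; case Eq: (next_vert _) => // _; exact: next_none Eq.
Qed.

Lemma completion_retract : retract (frep k P) (frep k completion).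
Proof.
have [|i iE] := @frep_lift k Q HQ P (frep k completion)
    (fun y s => bvec k y (inl s : completion) - bvec k y (inr y : completion)) wP.
  (* At a root of [P] the two basis vectors have the same parent, so their difference is killed, as
     the root is in [frep P]. *)
  move=> a s sa; rewrite linearB /= !frep_map_bvec //= sa next_arrow.
  by case: (par s) => [t|] //=; rewrite subrr.
have [|p pE] := @frep_lift k Q HQ completion (frep k P)
    (fun y s => if s is inl s then bvec k y s else 0) completion_wf.
  move=> a [s|q] /= sa.
    by rewrite frep_map_bvec //; case: (par s) => [t|] //=; case: (next_vert _).
  by rewrite linear0; case: (next_vert _).
exists i, p => x v; rewrite -[LHS]rh_compE -[RHS]rh_idE; move: v.
apply: frep_ext => s sx; rewrite rh_compE rh_idE iE // linearB /= !pE //.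
exact: subr0.
Qed.

End Completion.

Lemma forest_in_closure P : forest_wf P -> additive_closure (rep_H0 k R) (frep k P).
Proof.
move=> wP; apply/closure_retractP; exists (completion P); split.
- exact: completion_wf.
- exact: completion_total.
- exact: completion_retract.
Qed.

(** The closure is stable under retracts, so it contains both terms of a Fitting decomposition of
    [V]. Indecomposability within the closure therefore makes [V] local. *)
Lemma indecomposable_tree V : indecomposable_in (additive_closure (rep_H0 k R)) V ->
  exists P, [/\ forest_wf P, antichain P, exists r : P, forest_root r
    & rep_iso V (frep k P)].
Proof.
move=> [AV V0 Vind]; have /closure_retractP[P [wP _ VP]] := AV.
have [P' [wP' aP' PP']] := forest_reduce HQ k wP.
apply: (local_retract_tree HQ _ V0 (retract_trans VP (rep_iso_retract PP'))) => //.
move=> f; have [W [W' [VW W0 W'0]]] := fitting f.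
have rW : retract W V by apply: summand_retract; exists W'.
have rW' : retract W' V.
  have [g [h [gh hg]]] := VW; pose WW := fun b : bool => if b then W else W'.
  exists (rh_comp h (rh_in WW false)), (rh_comp (rh_pr WW false) g) => x v.
  by rewrite !rh_compE hg (rh_pr_in (V := WW) (i := false)).
have [] := Vind _ _ (closure_retract rW AV) (closure_retract rW' AV) VW.
  by right; exact: W0.
by left; exact: W'0.
Qed.

(** A decomposition gives the idempotent projecting onto [W]. If it is 0 then [W] vanishes, and if
    it is the identity then [W'] does. *)
Lemma tree_indecomposable P (r : P) V : forest_wf P -> antichain P -> forest_root r ->
  rep_iso V (frep k P) -> indecomposable_in (additive_closure (rep_H0 k R)) V.
Proof.
move=> wP aP rP VP; split.
- exact: closure_retract (rep_iso_retract VP) (forest_in_closure wP).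
- have [f [g [fg gf]]] := VP => V0.
  have /eqP[] := bvec_neq0 k (erefl (lab r)).
  by rewrite -[LHS]gf [g _ _]V0 linear0.
move=> W W' _ _ VW; have [f [g [fg gf]]] := rep_iso_trans (rep_iso_sym VP) VW.
pose WW := fun b : bool => if b then W else W'.
pose e := rh_comp g (rh_comp (rh_in WW true) (rh_comp (rh_pr WW true) f)).
have eE x v : e x v = g x (rh_in WW true x (rh_pr WW true x (f x v))).
  by rewrite /e 3!rh_compE.
case: (tree_idempotent HQ wP aP rP (f := e)) => [x v|e0|e1].
- by rewrite !eE gf rh_pr_in.
- left=> x w; have := e0 x (g x (rh_in WW true x w)).
  rewrite eE gf rh_pr_in => /(congr1 (f x)); rewrite gf linear0.
  by move=> /(congr1 (rh_pr WW true x)); rewrite rh_pr_in linear0.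
right=> x w; have := e1 x (g x (rh_in WW false x w)).
rewrite eE gf rh_pr_in_ne // !linear0 => /esym/(congr1 (f x)); rewrite gf linear0.
move=> /(congr1 (rh_pr WW false x)).
by rewrite (rh_pr_in (V := WW) (i := false)) linear0.
Qed.

End Closure.

(** * Reduced rooted tree modules *)

Lemma dsum_pr_in (k : fieldType) (I : finType) (V : I -> vectType k) i (v : V i) :
  dsum_pr V i (dsum_in V i v) = v.
Proof. by rewrite dsum_prE dsum_inE dfwith_in. Qed.

Lemma dsum_pr_in_ne (k : fieldType) (I : finType) (V : I -> vectType k) i j (v : V i) :
  i != j -> dsum_pr V j (dsum_in V i v) = 0.
Proof. by move=> ij; rewrite dsum_prE dsum_inE dfwith_out. Qed.

Section PushForwardTheory.
Variables (k : fieldType) (Q' Q : quiver) (f : qmor Q' Q) (V : rep k Q').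

Lemma push_map_in (a : arr Q) (b : fiber1 f a) v :
    (forall c : fiber1 f a, src (val c) = src (val b) -> c = b) ->
  rep_map (push_forward f V) a
    (dsum_in (fun y : fiber0 f (src a) => V (val y)) (fiber_src b) v) =
  dsum_in (fun y : fiber0 f (tgt a) => V (val y)) (fiber_tgt b) (rep_map V (val b) v).
Proof.
move=> bU; rewrite sum_lfunE (bigD1 b) //= big1 ?addr0 => [|c cb].
  by rewrite !comp_lfunE [X in rep_map V _ X](_ : _ = v) //; 
  exact: (@dsum_pr_in _ _ (fun y : fiber0 f (src a) => V (val y)) (fiber_src b)).
rewrite !comp_lfunE [X in rep_map V _ X](_ : _ = 0) ?linear0 //.
apply: (@dsum_pr_in_ne _ _ (fun y : fiber0 f (src a) => V (val y))
  (fiber_src b) (fiber_src c)).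
by apply: contraNneq cb => /(congr1 val) /= cb; apply/eqP/bU.
Qed.

Lemma push_map_in0 (a : arr Q) (z : fiber0 f (src a)) v :
    (forall c : fiber1 f a, src (val c) <> val z) ->
  rep_map (push_forward f V) a (dsum_in (fun y : fiber0 f (src a) => V (val y)) z v) = 0.
Proof.
move=> noc; rewrite sum_lfunE big1 // => c _.
rewrite !comp_lfunE [X in rep_map V _ X](_ : _ = 0) ?linear0 //.
apply: (@dsum_pr_in_ne _ _ (fun y : fiber0 f (src a) => V (val y)) z (fiber_src c)).
by apply/eqP => /(congr1 val) /= zc; exact: (noc c).
Qed.

End PushForwardTheory.

Lemma push2_map_in (k : fieldType) (Q2 Q1 Q : quiver) (g : qmor Q2 Q1) (f : qmor Q1 Q)
    (V : rep k Q2) (a : arr Q) (b : fiber1 f a) (c : fiber1 g (val b)) v w :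
    (forall d : fiber1 f a, src (val d) = src (val b) -> d = b) ->
    (forall d : fiber1 g (val b), src (val d) = src (val c) -> d = c) ->
    rep_map V (val c) v = w ->
  rep_map (push_forward f (push_forward g V)) a
    (dsum_in (fun y : fiber0 f (src a) => push_forward g V (val y)) (fiber_src b)
      (dsum_in (fun y : fiber0 g (src (val b)) => V (val y)) (fiber_src c) v)) =
  dsum_in (fun y : fiber0 f (tgt a) => push_forward g V (val y)) (fiber_tgt b)
    (dsum_in (fun y : fiber0 g (tgt (val b)) => V (val y)) (fiber_tgt c) w).
Proof.
move=> bU cU <-; rewrite (push_map_in (V := push_forward g V) _ bU).
by rewrite (push_map_in (V := V) _ cU).
Qed.

Section TreeForest.
Variables (k : fieldType) (Q : quiver).
Hypothesis HQ : rooted_tree_quiver Q.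

Section ForestOf.
Variables (x : Q) (T : rooted_tree_over (Defs.down x)).
Let HT := rto_tree T.
Let Hx := down_rooted_tree x HQ.

Definition forest_of : forest Q :=
  @Forest Q T (fun t => val (rto_mor T t)) (@next_vert T).

Lemma forest_of_wf : forest_wf forest_of.
Proof.
move=> s t /next_some[b <- <-]; exists (val (qmor1 (rto_mor T) b)) => /=.
  by rewrite (qmor_src (rto_mor T) b).
by rewrite (qmor_tgt (rto_mor T) b).
Qed.

Lemma forest_of_root : exists2 r : forest_of, forest_root r & lab r = x.
Proof.
have [r [rr ru]] := HT.2; exists r; last exact/Hx.2/rto_root.
split=> [|s /next_none/ru//]; case Er: (par _) => [t|//].
by have [b br _] := next_some Er; move/is_rootP: rr => /(_ b).
Qed.

Lemma forest_of_simulation (g : rto_hom T T) :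
  simulation (fun u w : forest_of => w = g u).
Proof.
move=> u _ ->; split; first by rewrite /= rto_hom_over0.
move=> u' /next_some[b <- <-]; exists (g (src b)) => //.
by rewrite -[LHS]/(next_vert (g (src b))) qmor_src (next_arrow HT) -qmor_tgt.
Qed.

(** An endomorphism fixes the root. If it fixes the parent of [u], it sends [u] to a sibling that
    simulates [u], hence to [u]. *)
Lemma antichain_reduced : antichain forest_of -> Defs.reduced T.
Proof.
move=> aT g; have gid u : g u = u.
  have [n] := ubnP (height (lab (u : forest_of))); elim: n u => // n IHn u.
  rewrite ltnS => un; case Eu: (next_vert u) => [q|]; last first.
    have [r [_ ru]] := HT.2; have ur := next_none Eu.
    by rewrite -(ru _ (rto_hom_root g ur)) -(ru _ ur).
  have gq : g q = q.
    have Eu' : par (u : forest_of) = Some q := Eu.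
    apply: IHn; exact: leq_trans (height_par HQ forest_of_wf Eu') un.
  have [|w pw uw] := (forest_of_simulation (erefl (g q))).2 u; first by rewrite [par _]Eu.
  apply/esym/(aT u (g u) q Eu); first by rewrite -uw pw gq.
  exists (fun u w : forest_of => w = g u) => //; exact: forest_of_simulation.
split=> // b; apply: (rooted_tree_arrow_inj HT).
by rewrite -qmor_src gid.
Qed.

(** The map from the tree below [v] to the tree below [v'], glued with the identity elsewhere, is an
    endomorphism over the base, so it fixes [v]. *)
Lemma reduced_antichain : Defs.reduced T -> antichain forest_of.
Proof.
move=> rT v v' t pv pv' sv; have wT := forest_of_wf.
have [h hv hE] := sim_fun HQ wT sv; pose D (u : T) := below (P := forest_of) v u.
have Dt : ~~ D t.
  apply/negP => /(height_below HQ wT)[tv|]; have := height_par HQ wT pv; rewrite ?tv ?ltnn //.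
  by move=> lt1 lt2; have := ltn_trans lt1 lt2; rewrite ltnn.
have next_src (b : arr T) : next_vert (src b) = Some (tgt b) by exact: next_arrow.
pose g0 u : T := if D u then h u else u.
(* An arrow from [g0 (src b)] to [g0 (tgt b)] exists as soon as [g0] commutes with [next_vert]. *)
have /choice[g1 g1E] : forall b : arr T, exists c : arr T,
    g0 (src b) = src c /\ g0 (tgt b) = tgt c.
  move=> b; suff /next_some[c <- <-] : next_vert (g0 (src b)) = Some (g0 (tgt b)) by exists c.
  rewrite /g0; case Db: (D (src b)); last first.
    case Db': (D (tgt b)); last exact: next_arrow.
    by rewrite /D (below_par (next_src b : par (src b : forest_of) = _) Db') in Db.
  case: (eqVneq (src b) v) => [bv|/eqP bv].
    have := next_src b; rewrite bv [next_vert v]pv => -[<-].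
    by rewrite hv [next_vert v']pv' (negPf Dt).
  have [_ /(_ bv)] := hE _ Db; rewrite /= next_src => ->.
  case/belowE: Db => // -[q]; rewrite [par _]next_src => -[<-] Dq.
  by rewrite [D _]Dq.
pose gm : qmor T T := @QMor T T g0 g1 (fun b => (g1E b).1) (fun b => (g1E b).2).
have over0 u : rto_mor T (g0 u) = rto_mor T u.
  by rewrite /g0; case Du: (D u) => //; apply: val_inj; exact: (hE u Du).1.
have groot r : is_root r -> is_root (gm r).
  move=> /is_rootP rr; apply/is_rootP; rewrite /= /g0; case Dr: (D r) => // a.
  case/belowE: Dr => [rv|[q /next_some[b br]]]; last by case: (rr b).
  by have [b bv _] := next_some pv; case: (rr b); rewrite rv.
have over1 b : qmor1 (rto_mor T) (qmor1 gm b) = qmor1 (rto_mor T) b.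
  by apply: (rooted_tree_arrow_inj Hx.1); rewrite -!qmor_src /= over0.
have [gid _] := rT (@RtoHom _ T T gm groot over0 over1).
by have := gid v; rewrite /= /g0 [D v]below_refl hv.
Qed.

(** An index of the iterated push-forward over [y] is a vertex [z] of [down x] over [y] and a vertex
    of [T] over [z]. The latter determines [z], so this is a fibre of [forest_of]. Nested indicator
    functions [b] avoid transport along labels. *)
Lemma tree_module_frep :
  rep_iso (push_forward (down_incl x) (linearization k T)) (frep k forest_of).
Proof.
pose W := push_forward (down_incl x) (push_forward (rto_mor T) (rep_const k T)).
pose b y (s : forest_of) : W y :=
  [ffun z : fiber0 (down_incl x) y =>
     ([ffun t : fiber0 (rto_mor T) (val z) => (val t == s)%:R : k^o] : dsum _)].
have bE y (z : fiber0 (down_incl x) y) (t : fiber0 (rto_mor T) (val z)) :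
    dsum_in (fun z : fiber0 (down_incl x) y =>
        push_forward (rto_mor T) (rep_const k T) (val z)) z
      (dsum_in (fun t : fiber0 (rto_mor T) (val z) => rep_const k T (val t)) t (1 : k^o)) =
    b y (val t).
  apply/ffunP => z'; rewrite dsum_inE ffunE; case: (eqVneq z z') => [<-|zz'].
    rewrite dfwith_in; apply/ffunP => t'; rewrite dsum_inE ffunE.
    case: (eqVneq t t') => [<-|tt']; first by rewrite dfwith_in eqxx.
    by rewrite dfwith_out // (inj_eq val_inj) eq_sym (negPf tt').
  rewrite dfwith_out //; apply/ffunP => t'; rewrite !ffunE.
  case: eqP => // tt'; case/eqP: zz'; apply: val_inj.
  by rewrite -(eqP (valP t)) -(eqP (valP t')) tt'.
pose zz y (u : fib forest_of y) : fiber0 (down_incl x) y :=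
  exist _ (rto_mor T (val u)) (proj2_sig u).
pose tt y (u : fib forest_of y) : fiber0 (rto_mor T) (val (zz y u)) :=
  exist (fun t => rto_mor T t == _) (val u) (eqxx _).
pose c y (w : W y) : frep_sp k forest_of y := [ffun u => (w : dsum _) (zz y u) (tt y u)].
have c_lin y : linear (@c y).
  move=> a v w; apply/ffunP => u.
  pose pz : 'Hom(W y, _) :=
    dsum_pr (fun z => push_forward (rto_mor T) (rep_const k T) (val z)) (zz y u).
  pose pt := dsum_pr (fun t : fiber0 _ (val (zz y u)) => rep_const k T (val t)) (tt y u).
  have pE w' : c y w' u = pt (pz w').
    by rewrite /pt /pz dsum_prE /c ffunE; congr (fun_of_fin _ (tt y u)); rewrite dsum_prE.
  rewrite pE !linearP.
  transitivity (a *: c y v u + c y w u); first by rewrite !pE.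
  by rewrite !ffunE.
pose co y : {linear W y -> frep_sp k forest_of y} :=
  HB.pack (@c y) (GRing.isLinear.Build _ _ _ _ _ (c_lin y)).
apply: (@frep_iso k Q HQ forest_of W b co).
- exact: forest_of_wf.
- move=> a s sa; case Es: (par s) => [t|] /=.
    have [e es et] := next_some Es; move: sa; rewrite -{}et -{}es => sa {Es}.
    have {sa} : val (qmor1 (rto_mor T) e) = a.
      by apply: (rooted_tree_arrow_inj HQ); rewrite -sa /= qmor_src.
    move=> ea; pose be : fiber1 (down_incl x) a :=
      exist _ (qmor1 (rto_mor T) e) (introT eqP ea).
    pose ge : fiber1 (rto_mor T) (val be) := exist (fun g => _ g == _) e (eqxx _).
    have := bE _ (fiber_src be) (fiber_src ge); rewrite [val (fiber_src ge)]/= => <-.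
    have := bE _ (fiber_tgt be) (fiber_tgt ge); rewrite [val (fiber_tgt ge)]/= => <-.
    apply: (@push2_map_in k _ _ _ (rto_mor T) (down_incl x) (rep_const k T) a be ge
      (1 : k^o) (1 : k^o)) => [d _|d dg|]; last exact: id_lfunE.
      by apply: val_inj; apply: val_inj; exact: etrans (eqP (valP d)) (esym (eqP (valP be))).
    by apply: val_inj; exact: (rooted_tree_arrow_inj HT).
  (* Here [s] is the root, which lies over [x], and no arrow of [down x] starts at [x]. *)
  pose z : fiber0 (down_incl x) (src a) := exist _ (rto_mor T s) (introT eqP sa).
  pose t : fiber0 (rto_mor T) (val z) := exist (fun t => rto_mor T t == _) s (eqxx _).
  rewrite -[s]/(val t) -bE; apply: (@push_map_in0 k _ _ (down_incl x)
    (push_forward (rto_mor T) (rep_const k T)) a z) => d dz.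
  have dx : val (src (val d)) = x.
    by rewrite dz /=; have [r rr rx] := forest_of_root; rewrite (rr.2 _ Es).
  exact: (elimT (is_rootP _) ((Hx.2 _).2 dx) (val d)).
- by move=> y s sy; apply/ffunP => u; rewrite !ffunE.
move=> y w w' /ffunP cw; apply/ffunP => z; apply/ffunP => t.
case: z t => z0 Hz [t0 Ht]; have tz := eqP Ht; rewrite /= in tz; subst z0.
have := cw (exist (fun s : forest_of => lab s == y) t0 Hz); rewrite !ffunE.
by rewrite (bool_irrelevance Ht (eqxx _)) => ctt; exact: ctt.
Qed.

End ForestOf.
End TreeForest.

Lemma forest_eta (Q : quiver) (P : forest Q) : @Forest Q P lab par = P.
Proof. by case: P. Qed.

Lemma uniq_map_inj (S T : eqType) (f : S -> T) (c : seq S) : uniq (map f c) ->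
  {in c &, injective f}.
Proof.
elim: c => //= a c IHc /andP[ac uc] x y; rewrite !inE.
move=> /predU1P[->|xc] /predU1P[->|yc] fxy //; last exact: IHc.
  by rewrite fxy (map_f f yc) in ac.
by rewrite -fxy (map_f f xc) in ac.
Qed.

(** * One-root forests as rooted tree quivers over [down (lab r)] *)

Section TreeOver.
Variables (Q : quiver) (P : forest Q) (r : P).
Hypotheses (HQ : rooted_tree_quiver Q) (wP : forest_wf P) (rP : forest_root r).

Lemma below_leQ (u v : P) : below v u -> leQ (lab u) (lab v).
Proof.
case/connectP => p; elim: p u => [|t p IHp] u /= => [_ ->|/andP[/eqP ut tp] vp].
  exact: connect0.
by have [a <- ta] := wP ut; apply: connect_trans (leQ_arrow a) _; rewrite ta; exact: IHp.
Qed.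

Lemma leQ_forest_root (s : P) : leQ (lab s) (lab r).
Proof. by have [t t0 /below_leQ] := below_root HQ s wP; rewrite (rP.2 _ t0). Qed.

Definition parent_arr := {s : P | par s != None}.
Definition parent_src (b : parent_arr) : P := val b.
(** The default is never taken, see [parent_arrE]. *)
Definition parent_tgt (b : parent_arr) : P := odflt (val b) (par (val b)).
Definition parent_quiver : quiver := Quiver parent_src parent_tgt.

Lemma parent_arrE (b : arr parent_quiver) : par (src b) = Some (tgt b).
Proof.
rewrite /= /parent_src /parent_tgt; have := valP b.
by case: (par (val b)).
Qed.

Lemma parent_arr_ex (s t : P) : par s = Some t ->
  exists2 b : arr parent_quiver, src b = s & tgt b = t.
Proof.
move=> st; have s0 : par s != None by rewrite st.
by exists (exist _ s s0); rewrite //= /parent_tgt /= st.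
Qed.

Lemma height_parent (b : arr parent_quiver) :
  (height (lab (tgt b : P)) < height (lab (src b : P)))%N.
Proof. exact (@height_par Q HQ P _ _ wP (parent_arrE b)). Qed.

Lemma parent_rootP (s : parent_quiver) : is_root s <-> par (s : P) = None.
Proof.
split=> [/is_rootP nob|s0].
  by case Es: (par _) => [t|//]; have [b /nob] := parent_arr_ex Es.
by apply/is_rootP => b bs; have := parent_arrE b; rewrite bs s0.
Qed.

(* A traversal of a cycle starting at a vertex of maximal height is preceded and
   followed by the same arrow. *)
Lemma parent_tree : rooted_tree_quiver parent_quiver.
Proof.
split; last first.
  exists r; split; first exact/parent_rootP/rP.1.
  by move=> s /parent_rootP/rP.2.
have conn (s : P) : connect (@adjacent parent_quiver) s r /\
                    connect (@adjacent parent_quiver) r s.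
  have [n] := ubnP (height (lab s)); elim: n s => // n IHn s; rewrite ltnS => sn.
  case Es: (par s) => [t|]; last by rewrite (rP.2 _ Es); split; exact: connect0.
  have [tr rt] := IHn t (leq_trans (height_par HQ wP Es) sn).
  have [b bs bt] := parent_arr_ex Es; split.
    apply: connect_trans tr; apply/connect1/existsP; exists (b, true).
    by rewrite /trav_start /trav_end /= -bs -bt !eqxx.
  apply: (connect_trans rt); apply/connect1/existsP; exists (b, false).
  by rewrite /trav_start /trav_end /= -bs -bt !eqxx.
split; first by apply/card_gt0P; exists r.
  by move=> s t; apply: connect_trans (conn s).1 (conn t).2.
move=> c; apply/negP => /and4P[c0 cyc us ua].
have [e0 e0c] : exists e0, e0 \in c by case: (c) c0 => // e s _; exists e; rewrite mem_head.
pose h (e : arr parent_quiver * bool) := height (lab (trav_start e : P)).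
have [e ec emax] := @arg_maxnP _ e0 (mem c) h e0c.
have := next_cycle cyc ec; have := prev_cycle cyc ec.
have := emax _ (etrans (mem_prev c e) ec); have := emax _ (etrans (mem_next c e) ec).
case: (prev c e) (etrans (mem_prev c e) ec) => b' d'.
case: e ec emax => b [] ec emax b'c; rewrite /h /trav_start /trav_end /= => lt_next lt_prev.
  case: d' b'c lt_prev => b'c lt_prev /eqP bb' _.
    by move: lt_prev; rewrite -bb' leqNgt height_parent.
  have bb : b' = b by apply: val_inj.
  by have := uniq_map_inj ua ec b'c; rewrite bb => /(_ erefl).
move=> _ /eqP bn; move: lt_next; rewrite -/(trav_start _) -bn.
by rewrite leqNgt height_parent.
Qed.

Definition parent_vert (s : parent_quiver) : Defs.down (lab r) :=
  exist (fun y => leQ y (lab r)) (lab (s : P)) (leQ_forest_root s).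

Fact parent_down_ex (b : arr parent_quiver) : exists a : arr (Defs.down (lab r)),
  parent_vert (src b) = src a /\ parent_vert (tgt b) = tgt a.
Proof.
have [a sa ta] := wP (parent_arrE b).
have aP : leQ (src a) (lab r) && leQ (tgt a) (lab r) by rewrite sa ta !leQ_forest_root.
by exists (exist _ a aP); split; apply: val_inj.
Qed.

Definition parent_mor : qmor parent_quiver (Defs.down (lab r)) :=
  @QMor parent_quiver (Defs.down (lab r)) parent_vert
    (fun b => sval (cid (parent_down_ex b)))
    (fun b => (svalP (cid (parent_down_ex b))).1)
    (fun b => (svalP (cid (parent_down_ex b))).2).

Lemma parent_mor_root s : is_root s -> is_root (parent_mor s).
Proof.
move=> /parent_rootP/rP.2 ->; exact/(down_rooted_tree (lab r) HQ).2.
Qed.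

Definition tree_over : rooted_tree_over (Defs.down (lab r)) :=
  RootedTreeOver parent_tree parent_mor_root.

(** An equality rather than an isomorphism: vertices and labels agree by computation. It lets the
    results on [forest_of] be rewritten to [P]. *)
Lemma forest_of_tree_over : forest_of tree_over = P.
Proof.
rewrite -[RHS]forest_eta /forest_of; congr Forest; apply/funext => s.
case Es: (next_vert s) => [t|].
  by have [b <- <-] := next_some Es; rewrite parent_arrE.
by rewrite (parent_rootP s).1 //; exact: next_none Es.
Qed.

End TreeOver.

Lemma reduced_moduleP (k : fieldType) (Q : quiver) (V : rep k Q) : rooted_tree_quiver Q ->
  reduced_rooted_tree_module V <->
  exists P, [/\ forest_wf P, antichain P, exists r : P, forest_root r & rep_iso V (frep k P)].
Proof.
move=> HQ; split=> [[x [T [rT VT]]]|[P [wP aP [r rP] VP]]].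
  exists (forest_of T); split.
  - exact: forest_of_wf.
  - exact: reduced_antichain.
  - by have [r rr _] := forest_of_root HQ T; exists r.
  - exact: rep_iso_trans VT (tree_module_frep k HQ T).
exists (lab r), (tree_over HQ wP rP); have TE := forest_of_tree_over HQ wP rP; split.
  by apply: antichain_reduced => //; rewrite TE.
apply: (rep_iso_trans VP); apply: rep_iso_sym.
by have := tree_module_frep k HQ (tree_over HQ wP rP); rewrite TE.
Qed.

(** * Finiteness of the set of antichain trees *)

Section Finiteness.
Variables (k : fieldType) (Q : quiver).
Hypothesis HQ : rooted_tree_quiver Q.
Implicit Types P : forest Q.

(* The isomorphism type of the tree below a vertex of an antichain forest is
   determined by the set of isomorphism types of the trees below its children. *)
Fixpoint code_type (n : nat) : finType :=
  if n is m.+1 then {set Q * code_type m} : finType else unit.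

Fixpoint code P (n : nat) : P -> code_type n :=
  match n return P -> code_type n with
  | 0 => fun _ => tt
  | m.+1 => fun u => [set (lab w, code m w) | w in [pred w | par w == Some u]]%SET
  end.

(** Equality of codes of depth [n] is a simulation as long as [n] plus the height of the label is at
    least [#|Q|]. When the depth runs out, the height is maximal and there are no children. *)
Lemma code_sim P (u w : P) : forest_wf P ->
  lab u = lab w -> code #|Q| u = code #|Q| w -> sim u w.
Proof.
move=> wP uw cuw; exists (fun u w : P => lab u = lab w /\
    exists2 n, (#|Q| <= n + height (lab u))%N & code n u = code n w); last first.
  by split=> //; exists #|Q| => //; exact: leq_addr.
move=> {uw cuw}u {}w [uw [n un cuw]]; split=> // u' u'u.
have hu := height_par HQ wP u'u; case: n un cuw => [|n] un cuw.
  by have := leq_trans hu (leq_trans (height_le (lab u')) un); rewrite ltnn.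
have /imsetP[w' + [u'w' cu'w']] : (lab u', code n u') \in code n.+1 w.
  by rewrite -cuw; apply/imsetP; exists u'; rewrite // inE u'u.
rewrite inE => /eqP w'w; exists w' => //; split=> //; exists n => //.
by apply: leq_trans un _; rewrite addSnnS leq_add2l.
Qed.

Fixpoint key_type (m : nat) : finType :=
  if m is m'.+1 then (Q * code_type #|Q| * option (key_type m'))%type : finType else unit.

(** The labels and codes met on the way from [s] to the root, truncated after [m] vertices. *)
Fixpoint key P (m : nat) : P -> key_type m :=
  match m return P -> key_type m with
  | 0 => fun _ => tt
  | m'.+1 => fun s => (lab s, code #|Q| s, omap (key m') (par s))
  end.

(** By induction the parents are equal; siblings with equal labels and codes simulate each other, so
    the antichain condition identifies them. *)
Lemma key_inj P (r : P) m (s s' : P) : forest_wf P -> antichain P -> forest_root r ->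
  (height (lab s) <= m)%N -> key m s = key m s' -> s = s'.
Proof.
move=> wP aP rP; elim: m s s' => [|m IHm] s s' sm.
  move: sm; rewrite leqn0 => /eqP/card0_eq/(_ (lab s)).
  by rewrite !inE => /negP[]; exact: connect0.
case=> ss' cs; case Es: (par s) => [t|]; case Es': (par s') => [t'|] //=.
  move=> [/IHm tt']; apply: (aP _ _ t Es); last exact: code_sim.
  rewrite Es' tt' // -ltnS; exact: leq_trans (height_par HQ wP Es) sm.
by move=> _; rewrite (rP.2 _ Es) (rP.2 _ Es').
Qed.

Lemma card_antichain_tree P (r : P) : forest_wf P -> antichain P -> forest_root r ->
  (#|P| <= #|key_type #|Q| |)%N.
Proof.
move=> wP aP rP; apply: (leq_card (@key P #|Q|)) => s s'.
exact: (key_inj wP aP rP (height_le (lab s))).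
Qed.

Lemma frep_bij P P' (f : P -> P') (g : P' -> P) : forest_wf P -> forest_wf P' ->
    cancel f g -> cancel g f -> (forall s, lab (f s) = lab s) ->
    (forall s, par (f s) = omap f (par s)) -> rep_iso (frep k P) (frep k P').
Proof.
move=> wP wP' fg gf flab fpar.
have glab s : lab (g s) = lab s by rewrite -flab gf.
have gpar s : par (g s) = omap g (par s).
  by rewrite -[s in RHS]gf fpar; case: (par _) => //= t; rewrite fg.
have [|F FE] := @frep_lift k Q HQ P (frep k P') (fun y s => bvec k y (f s)) wP.
  by move=> a s sa; rewrite frep_map_bvec ?flab // fpar; case: (par s).
have [|G GE] := @frep_lift k Q HQ P' (frep k P) (fun y s => bvec k y (g s)) wP'.
  by move=> a s sa; rewrite frep_map_bvec ?glab // gpar; case: (par s).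
exists F, G; split=> y v; rewrite -[LHS]rh_compE -[RHS]rh_idE; move: v.
  by apply: frep_ext => s sy; rewrite rh_compE rh_idE FE // GE ?flab // fg.
by apply: frep_ext => s sy; rewrite rh_compE rh_idE GE // FE ?glab // gf.
Qed.

(** With the number of vertices bounded, the list consists of all labels and parent maps on ordinals
    up to the bound, well-formed or not. *)
Lemma finite_antichain_trees : exists (n : nat) (F : 'I_n -> rep k Q),
  forall P (r : P), forest_wf P -> antichain P -> forest_root r ->
  exists i, rep_iso (frep k P) (F i).
Proof.
pose N := #|key_type #|Q| |.
pose I : finType := {m : 'I_N.+1 & ({ffun 'I_m -> Q} * {ffun 'I_m -> option 'I_m})%type}.
pose FI (i : I) : rep k Q :=
  frep k (@Forest Q 'I_(tag i) (tagged i).1 (tagged i).2).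
exists #|I|, (fun i => FI (enum_val i)) => P r wP aP rP.
have PN : (#|P| < N.+1)%N by rewrite ltnS; exact: card_antichain_tree aP rP.
pose m : 'I_N.+1 := Ordinal PN.
pose fl : {ffun 'I_m -> Q} := [ffun j => lab (enum_val j : P)].
pose fp : {ffun 'I_m -> option 'I_m} := [ffun j => omap enum_rank (par (enum_val j : P))].
pose i : I := Tagged (fun m : 'I_N.+1 =>
  ({ffun 'I_m -> Q} * {ffun 'I_m -> option 'I_m})%type) (fl, fp).
pose P' := @Forest Q 'I_m fl fp.
exists (enum_rank i); rewrite enum_rankK -[FI i]/(frep k P').
apply: (@frep_bij P P' (fun s => enum_rank s) (fun j => enum_val (j : 'I_#|P|))) => //.
- move=> s t /=; rewrite !ffunE; case Es: (par _) => [u|//] [<-].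
  by rewrite enum_rankK; exact: wP Es.
- exact: enum_rankK.
- exact: enum_valK.
- by move=> s; rewrite /= ffunE enum_rankK.
- by move=> s; rewrite /= ffunE enum_rankK.
Qed.

End Finiteness.

Theorem corollaryC (R : realType) (k : fieldType) (Q : quiver)
    (HQ : rooted_tree_quiver Q) :
  finite_type (additive_closure (@rep_H0 k R Q)) /\
  (forall V : rep k Q,
     indecomposable_in (additive_closure (@rep_H0 k R Q)) V <->
     reduced_rooted_tree_module V).
Proof.
split.
  have [n [F FP]] := finite_antichain_trees k HQ; exists n, F => V.
  move=> /(indecomposable_tree HQ)[P [wP aP [r rP] VP]].
  have [i Pi] := FP P r wP aP rP; exists i; exact: rep_iso_trans VP Pi.
move=> V; rewrite reduced_moduleP //; split; first exact: indecomposable_tree.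
by move=> [P [wP aP [r rP] VP]]; exact: tree_indecomposable HQ P r V wP aP rP VP.
Qed.
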